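(* Let $\psi_m=\nu(\phi_p,\delta_q)\psi_q+\lambda(\phi_p)\psi_p$, with $\nu\in R[\xi_p,\xi_q]$ and $\lambda\in R[\xi_p]$, be a non-degenerate $\{\delta_p,\delta_q\}$-character of $\mathbb G_m$ over $R$, with set $\mathcal K$ of characteristic integers, $\mathcal K_\pm$ the subsets of positive (resp. negative) elements, $\rho_\pm=\#\mathcal K_\pm$, and $\mathcal U_{\pm1}=\{u\in1+q^{\pm1}R[[q^{\pm1}]]:\psi_mu=0\}$. For $u\in R[[q^{\pm1}]]^\times$ let $B^0_\kappa u$ be the coefficient of $q^\kappa$ in $\psi_qu$, and $B^0_\pm u=(B^0_\kappa u)_{\kappa\in\mathcal K_\pm}$. Then the maps $B^0_\pm:\mathcal U_{\pm1}\to R^{\rho_\pm}$ are isomorphisms of $R$-modules ($\mathcal U_{\pm1}$ being an $R$-module under convolution $\star$). Furthermore, for any $u\in\mathcal U_{\pm1}$, in the (multiplicatively written) group $\mathcal U_{\pm1}$, $$u=\prod_{\kappa\in\mathcal K_\pm}(B^0_\kappa u)\star u_{m,\kappa,1}.$$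
   Context: $p\ne 2$ is a prime, $R$ is the completion of the maximal unramified extension of $\mathbb Z_p$, $\phi:R\to R$ the unique automorphism lifting the $p$-power Frobenius on $k=R/pR$, $\mu(R)$ the group of roots of unity of $R$. On $R[[q^{\pm1}]]$: $\phi_p(\sum a_nq^n)=\sum\phi(a_n)q^{pn}$, $\delta_pu=\frac{\phi_p(u)-u^p}{p}$, $\delta_q(\sum a_nq^n)=\sum na_nq^n$. For invertible $u$: $\psi_q(u)=\frac{\delta_qu}{u}$, $\psi_p(u)=\frac1p\log\frac{\phi_p(u)}{u^p}=\sum_{n\ge1}(-1)^{n-1}\frac{p^{n-1}}{n}\left(\frac{\delta_pu}{u^p}\right)^n$. For a polynomial $\nu=\sum\nu_{ij}\xi_p^i\xi_q^j$, $\nu(\phi_p,\delta_q)=\sum\nu_{ij}\phi_p^i\delta_q^j$. The characteristic polynomial of $\psi_m$ is $$\mu(\xi_p,\xi_q)=\nu(p\xi_p,\xi_q)\xi_q+\lambda(p\xi_p)(\xi_p-1)=\sum\mu_{ij}\xi_p^i\xi_q^j.$$ $\psi_m$ is non-degenerate if $\mu(0,0)\in R^\times$ (equivalently $\lambda(0)\in R^\times$). A characteristic integer is $\kappa\in\mathbb Z$ with $\mu(0,\kappa)=0$ (such $\kappa$ is then prime to $p$). Basic series: for $\kappa\in\mathbb Z\setminus p\mathbb Z$, $\alpha\in R$, $$u_{m,\kappa,\alpha}=\exp\Big(\sum_{n\ge0}b_{n,\kappa}\,\phi^n(\alpha)\,\frac{q^{\kappa p^n}}{\kappa p^n}\Big)\in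 1+q^{\pm1}R[[q^{\pm1}]],$$ where $b_{0,\kappa}=1$ and, for $n\ge1$, $$b_{n,\kappa}=-\frac{\sum_{s=1}^n\big(\sum_{j\ge0}\mu_{sj}\kappa^jp^{j(n-s)}\big)\phi^s(b_{n-s,\kappa})}{\sum_{j\ge0}\mu_{0j}\kappa^jp^{jn}}\in R.$$ Convolution: $\mathcal U_{\pm1}$ is the internal direct product over $\kappa\in\mathcal K_\pm$ of the groups $\{u_{m,\kappa,\alpha}:\alpha\in R\}$. The $p$-adic completion $\mathbb Z\mu(R)\hat{\ }$ of the group ring of $\mu(R)$ acts on $1+q^{\pm1}R[[q^{\pm1}]]$ by $(f\star u)(q)=\prod_\zeta u(\zeta q)^{f(\zeta)}$. For $\kappa$ prime to $p$, on $\{u_{m,\kappa,\alpha}:\alpha\in R\}$ this factors through the surjective ring homomorphism $\mathbb Z\mu(R)\hat{\ }\to R$, $f\mapsto\sum_\zeta f(\zeta)\zeta^\kappa$, giving an $R$-module structure $\star$, explicitly $\beta\star u_{m,\kappa,\alpha}=u_{m,\kappa,\beta\alpha}$. The $R$-module structure on $\mathcal U_{\pm1}$ is the direct sum of these. *)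

(* Defs.v *)
From HB Require Import structures.
From mathcomp Require Import all_boot all_order all_algebra fraction.
From mathcomp Require Import finmap.
From mathcomp Require Import boolp classical_sets functions cardinality.

Set Implicit Arguments.
Unset Strict Implicit.
Unset Printing Implicit Defensive.

Import Order.TTheory GRing.Theory Num.Theory.
Local Open Scope ring_scope.

(* [{qseries e, R}] is R[[q]] if e = false and R[[q^-1]] if e = true:
   [qcoef u n] is the coefficient of q^n, resp. of q^-n. *)
Record qseries (e : bool) (R : Type) := QSeries { qcoef : nat -> R }.
Notation "{ 'qseries' e , R }" := (qseries e R)
  (at level 0, e at level 99, R at level 99, format "{ 'qseries'  e ,  R }").

(* The exponent of q in the n-th monomial. *)
Definition qexp (e : bool) (n : nat) : int := (-1) ^+ e * n%:Z.

(* Instances for an arbitrary coefficient type exist by excluded middle and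
   choice. *)
HB.instance Definition _ (e : bool) (R : Type) := gen_eqMixin {qseries e, R}.
HB.instance Definition _ (e : bool) (R : Type) :=
  gen_choiceMixin {qseries e, R}.

Lemma qseriesP (e : bool) (R : Type) (u v : {qseries e, R}) :
  (forall n, qcoef u n = qcoef v n) -> u = v.
Proof. by case: u v => [u] [v] /= /funext ->. Qed.

Section QSeriesZmod.
Variables (e : bool) (R : nmodType).
Implicit Types u v : {qseries e, R}.

Definition qzero : {qseries e, R} := QSeries e (fun=> 0).
Definition qadd u v : {qseries e, R} :=
  QSeries e (fun n => qcoef u n + qcoef v n).

Lemma qaddA : associative qadd.
Proof. by move=> u v w; apply: qseriesP => n; rewrite /= addrA. Qed.
Lemma qaddC : commutative qadd.
Proof. by move=> u v; apply: qseriesP => n; rewrite /= addrC. Qed.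
Lemma qadd0 : left_id qzero qadd.
Proof. by move=> u; apply: qseriesP => n; rewrite /= add0r. Qed.

HB.instance Definition _ := GRing.isNmodule.Build {qseries e, R}
  qaddA qaddC qadd0.
End QSeriesZmod.

Section QSeriesOpp.
Variables (e : bool) (R : zmodType).

Definition qopp (u : {qseries e, R}) : {qseries e, R} :=
  QSeries e (fun n => - qcoef u n).

Lemma qaddN : left_inverse 0 qopp +%R.
Proof. by move=> u; apply: qseriesP => n; rewrite /= addNr. Qed.

HB.instance Definition _ := GRing.Nmodule_isZmodule.Build {qseries e, R} qaddN.
End QSeriesOpp.

Section QSeriesRing.
Variables (e : bool) (R : comNzRingType).
Implicit Types u v w : {qseries e, R}.

Definition qone : {qseries e, R} := QSeries e (fun n => (n == 0%N)%:R).
Definition qmul u v : {qseries e, R} :=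
  QSeries e (fun n => \sum_(i < n.+1) qcoef u i * qcoef v (n - i)%N).

Definition qtrunc N u : {poly R} := \poly_(i < N) qcoef u i.

Lemma qtruncM N u v n : (n < N)%N ->
  qcoef (qmul u v) n = (qtrunc N u * qtrunc N v)`_n.
Proof.
move=> ltnN; rewrite coefM /=; apply: eq_bigr => -[i /=]; rewrite ltnS => lein _.
by rewrite !coef_poly (leq_ltn_trans lein ltnN) (leq_ltn_trans (leq_subr _ _)).
Qed.

Lemma qmulA : associative qmul.
Proof.
move=> u v w; apply: qseriesP => n.
have low (s t : {poly R}) (x y : {qseries e, R}) : 
    (forall i, (i <= n)%N -> s`_i = qcoef x i) ->
    (forall i, (i <= n)%N -> t`_i = qcoef y i) -> (s * t)`_n = qcoef (qmul x y) n.
  move=> hs ht; rewrite coefM /=; apply: eq_bigr => -[i /=]; rewrite ltnS => lein _.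
  by rewrite hs // ht // leq_subr.
have tr x i : (i <= n)%N -> (qtrunc n.+1 x)`_i = qcoef x i.
  by move=> lein; rewrite coef_poly ltnS lein.
rewrite -(low (qtrunc n.+1 u) (qtrunc n.+1 v * qtrunc n.+1 w)).
- rewrite mulrA; apply: low; last exact: tr.
  by move=> i lein; rewrite (@qtruncM n.+1).
- exact: tr.
- by move=> i lein; rewrite (@qtruncM n.+1).
Qed.

Lemma qmulC : commutative qmul.
Proof.
by move=> u v; apply: qseriesP => n; rewrite !(@qtruncM n.+1) // mulrC.
Qed.

Lemma qmul1 : left_id qone qmul.
Proof.
move=> u; apply: qseriesP => n /=.
rewrite big_ord_recl /= mul1r subn0 big1 ?addr0 // => i _.
by rewrite /= mul0r.
Qed.

Lemma qmulDl : left_distributive qmul +%R.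
Proof.
move=> u v w; apply: qseriesP => n /=; rewrite -big_split /=.
by apply: eq_bigr => i _; rewrite mulrDl.
Qed.

Lemma qone_neq0 : qone != 0.
Proof.
apply/eqP => /(congr1 (fun u : {qseries e, R} => qcoef u 0)) /= /eqP.
by rewrite oner_eq0.
Qed.

HB.instance Definition _ := GRing.Zmodule_isComNzRing.Build {qseries e, R}
  qmulA qmulC qmul1 qmulDl qone_neq0.

Definition qscale (c : R) u : {qseries e, R} :=
  QSeries e (fun n => c * qcoef u n).

Lemma qscaleA a b u : qscale a (qscale b u) = qscale (a * b) u.
Proof. by apply: qseriesP => n; rewrite /= mulrA. Qed.
Lemma qscale1 : left_id 1 qscale.
Proof. by move=> u; apply: qseriesP => n; rewrite /= mul1r. Qed.
Lemma qscaleDr : right_distributive qscale +%R.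
Proof. by move=> c u v; apply: qseriesP => n; rewrite /= mulrDr. Qed.
Lemma qscaleDl u : {morph qscale^~ u : a b / a + b}.
Proof. by move=> a b; apply: qseriesP => n; rewrite /= mulrDl. Qed.

HB.instance Definition _ := GRing.Zmodule_isLmodule.Build R {qseries e, R}
  qscaleA qscale1 qscaleDr qscaleDl.

Lemma qcoefD u v n : qcoef (u + v) n = qcoef u n + qcoef v n.
Proof. by []. Qed.
Lemma qcoefN u n : qcoef (- u) n = - qcoef u n.
Proof. by []. Qed.
Lemma qcoefZ c u n : qcoef (c *: u) n = c * qcoef u n.
Proof. by []. Qed.
Lemma qcoefM u v n :
  qcoef (u * v) n = \sum_(i < n.+1) qcoef u i * qcoef v (n - i)%N.
Proof. by []. Qed.
Lemma qcoef1 n : qcoef (1 : {qseries e, R}) n = (n == 0%N)%:R.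
Proof. by []. Qed.
Lemma qcoef_sum (I : Type) (r : seq I) (P : pred I) (F : I -> {qseries e, R}) n :
  qcoef (\sum_(i <- r | P i) F i) n = \sum_(i <- r | P i) qcoef (F i) n.
Proof. exact: (big_morph (fun u : {qseries e, R} => qcoef u n)). Qed.

Lemma qcoefX_small u k n : qcoef u 0 = 0 -> (n < k)%N -> qcoef (u ^+ k) n = 0.
Proof.
move=> u0; elim: k n => // k IHk n; rewrite ltnS => lenk.
rewrite exprS qcoefM big1 // => -[[|i] /= lein _]; first by rewrite u0 mul0r.
rewrite IHk ?mulr0 // (leq_trans _ lenk) // ltn_subrL /=.
exact: leq_ltn_trans (leq0n i) lein.
Qed.
End QSeriesRing.

Section QSeriesUnitRing.
Variables (e : bool) (R : comUnitRingType).
Implicit Types u v : {qseries e, R}.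

Definition qunit : {pred {qseries e, R}} := [pred u | qcoef u 0 \is a GRing.unit].

(* For x = 1 - u / u_0 one has 1 / u = u_0^-1 (1 + x + x^2 + ...). *)
Definition qinv u : {qseries e, R} :=
  if u \in qunit then
    (qcoef u 0)^-1 *:
      QSeries e (fun n => \sum_(k < n.+1) qcoef ((1 - (qcoef u 0)^-1 *: u) ^+ k) n)
  else u.

Lemma qmulVx : {in qunit, left_inverse 1 qinv *%R}.
Proof.
move=> u uU; rewrite /qinv uU; set c := (qcoef u 0)^-1.
set x := 1 - c *: u; set g := QSeries _ _.
have x0 : qcoef x 0 = 0 by rewrite /x qcoefD qcoefN qcoefZ qcoef1 mulVr ?subrr.
have -> : c *: g * u = g * (1 - x).
  rewrite opprB addrC subrK; apply: qseriesP => n; rewrite !qcoefM.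
  by apply: eq_bigr => i _; rewrite !qcoefZ mulrCA mulrA.
apply: qseriesP => n.
have -> : qcoef (g * (1 - x)) n = qcoef ((\sum_(k < n.+1) x ^+ k) * (1 - x)) n.
  rewrite !qcoefM; apply: eq_bigr => -[i /=]; rewrite ltnS => lein _; congr (_ * _).
  rewrite qcoef_sum /= -!(big_mkord xpredT (fun k => qcoef (x ^+ k) i)).
  rewrite [RHS](big_cat_nat (n := i.+1)) //=.
  rewrite [X in _ = _ + X]big_nat [X in _ = _ + X]big1 ?addr0 // => k /andP[ltik _].
  exact: qcoefX_small.
rewrite mulrC -opprB mulNr -subrX1 opprB qcoefD qcoefN qcoefX_small ?oppr0 //.
exact: addr0.
Qed.

Lemma qunitPl u v : v * u = 1 -> qunit u.
Proof.
move=> /(congr1 (fun w : {qseries e, R} => qcoef w 0)).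
by rewrite qcoefM big_ord1 subnn qcoef1 => vu1; apply/unitrPr; exists (qcoef v 0); rewrite mulrC.
Qed.

Lemma qinv_out : {in [predC qunit], qinv =1 id}.
Proof. by move=> u; rewrite /qinv inE => /negbTE uNU; rewrite ifF. Qed.

HB.instance Definition _ := GRing.ComNzRing_hasMulInverse.Build {qseries e, R}
  qmulVx qunitPl qinv_out.
End QSeriesUnitRing.

Local Open Scope classical_set_scope.

Definition pdvd (p : nat) (R : idomainType) (k : nat) (x : R) : Prop :=
  exists y : R, x = p%:R ^+ k * y.

(* The completion of the maximal unramified extension of Z_p, for p prime, is
   the complete discrete valuation ring of characteristic 0 with maximal ideal
   (p) and residue field an algebraic closure of F_p; these properties determine
   it up to isomorphism (Serre, Local Fields, II.5).  For a p-adically complete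
   and separated domain with p != 0, it suffices to prescribe the quotient by p:
   elements outside (p) are then units, by completeness. *)
Record is_completed_Zp_ur (p : nat) (R : idomainType) : Prop := {
  Zp_ur_p_neq0 : p%:R != 0 :> R;
  Zp_ur_separated : forall x : R, (forall k, pdvd p k x) -> x = 0;
  Zp_ur_complete : forall s : nat -> R,
    (forall n, pdvd p n (s n.+1 - s n)) ->
    exists l : R, forall n, pdvd p n (l - s n);
  Zp_ur_residue : exists (k : closedFieldType) (red : {rmorphism R -> k}),
    [/\ forall y : k, exists x : R, red x = y,
        forall x : R, red x = 0 <-> pdvd p 1 x
      & forall y : k, exists2 f : {poly int},
          map_poly intr f != 0 :> {poly k} & root (map_poly intr f) y] }.

Definition lifts_frobenius (p : nat) (R : idomainType) (phi : R -> R) : Prop :=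
  forall x : R, pdvd p 1 (phi x - x ^+ p).

Section Limits.
Variables (p : nat) (R : idomainType).

(* The p-adic limit of a sequence; 0 if there is none. *)
Definition plim (s : nat -> R) : R :=
  xget 0 [set l | forall k, exists N, forall n, (N <= n)%N -> pdvd p k (s n - l)].

Definition qlim (e : bool) (s : nat -> {qseries e, R}) : {qseries e, R} :=
  QSeries e (fun i => plim (fun n => qcoef (s n) i)).

(* The element of R equal to a given element of Frac(R); 0 if there is none. *)
Definition descend (x : {fraction R}) : R := xget 0 [set a | tofrac a = x].

End Limits.

Section Operators.
Variables (p : nat) (R : idomainType) (phi : R -> R) (e : bool).
Implicit Types u v : {qseries e, R}.

Definition qphi u : {qseries e, R} :=
  QSeries e (fun n => if (p %| n)%N then phi (qcoef u (n %/ p)) else 0).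

Definition delta_p u : {qseries e, R} :=
  QSeries e (fun n => descend (tofrac (qcoef (qphi u - u ^+ p) n) / p%:R)).

Definition delta_q u : {qseries e, R} :=
  QSeries e (fun n => (qexp e n)%:~R * qcoef u n).

Definition psi_q u : {qseries e, R} := delta_q u / u.

Definition psi_p u : {qseries e, R} :=
  qlim p (fun N => \sum_(1 <= n < N)
    descend ((-1) ^+ n.-1 * p%:R ^+ n.-1 / n%:R) *: (delta_p u / u ^+ p) ^+ n).

(* Throughout, {poly {poly R}} stands for R[xi_p, xi_q] with xi_p the outer
   variable: the coefficient of xi_p^i xi_q^j in nu is nu`_i`_j. *)
Definition psi (nu : {poly {poly R}}) (lam : {poly R}) u : {qseries e, R} :=
  \sum_(i < size nu) \sum_(j < size nu`_i)
     nu`_i`_j *: iter i qphi (iter j delta_q (psi_q u)) +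
  \sum_(i < size lam) lam`_i *: iter i qphi (psi_p u).

End Operators.

Section Symbol.
Variables (p : nat) (R : idomainType) (nu : {poly {poly R}}) (lam : {poly R}).

Definition char_poly_mu : {poly {poly R}} :=
  (nu \Po (p%:R *: 'X)) * 'X%:P + (map_poly polyC lam \Po (p%:R *: 'X)) * ('X - 1).

Definition nondegenerate_char : Prop := char_poly_mu.[0].[0] \is a GRing.unit.

Definition char_integer (kappa : int) : Prop :=
  char_poly_mu.[0].[kappa%:~R] = 0.

Definition char_integers (e : bool) : set int :=
  [set kappa | char_integer kappa /\ 0 < (-1) ^+ e * kappa].

Definition K_ (e : bool) : {fset int} := fset_set (char_integers e).

(* In the non-degenerate case mu(0, xi_q) is nonzero, so that K_ e is really the
   set of characteristic integers of the given sign. *)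
Lemma mem_K_ e kappa : prime p -> is_completed_Zp_ur p R -> nondegenerate_char ->
  kappa \in K_ e <-> char_integers e kappa.
Proof.
move=> p_pr R_ur ndg.
have ndivp m : (0 < m)%N -> ~~ (p %| m)%N -> m%:R != 0 :> R.
  move=> m_gt0 pNm; apply/eqP => m0.
  have [k [red [_ redP _]]] := Zp_ur_residue R_ur.
  have redp : red p%:R = 0 by apply/redP; exists 1; rewrite mulr1.
  have : coprime m p by rewrite coprime_sym prime_coprime.
  case: (egcdnP p m_gt0) => a b Eab _; rewrite /coprime => /eqP gcd1.
  move: Eab => /(congr1 (fun n => red n%:R)); rewrite gcd1 !(natrD, natrM, rmorphD, rmorphM) /=.
  by rewrite m0 redp !rmorph0 !mulr0 add0r rmorph1 => /esym /eqP; rewrite oner_eq0.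
have nat_neq0 m : (0 < m)%N -> m%:R != 0 :> R.
  move=> m_gt0; rewrite -(partnC p m_gt0) natrM mulf_neq0 //.
    by rewrite p_part natrX expf_neq0 // Zp_ur_p_neq0.
  by rewrite ndivp ?part_gt0 // -p'natE // part_pnat.
have intr_inj' : injective (intr : int -> R).
  move=> x y /eqP; rewrite -subr_eq0 -intrB => xy0; apply/eqP; rewrite -subr_eq0.
  apply: contraTT xy0; case: (x - y) => n n0.
    by rewrite -pmulrn nat_neq0 // lt0n; apply: contraNN n0 => /eqP ->.
  by rewrite NegzE mulrNz oppr_eq0 -pmulrn nat_neq0.
suff fin : finite_set (char_integers e).
  by rewrite in_fset_set // inE.
set q := char_poly_mu.[0].
have q_neq0 : q != 0.
  by apply: contraTneq ndg; rewrite /nondegenerate_char -/q => ->; rewrite horner0 unitr0.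
apply: contrapT => /(infinite_set_fset (size q)) [X XK leX].
have := @max_poly_roots _ q [seq x%:~R | x <- X] q_neq0.
rewrite map_inj_uniq // fset_uniq size_map ltnNge leX => /(_ _ isT) H.
apply/notF/H/allP => _ /mapP[x xX ->]; apply/eqP.
by have [] := XK _ xX.
Qed.

End Symbol.

Section BasicSeries.
Variables (p : nat) (R : idomainType) (phi : R -> R).
Variables (nu : {poly {poly R}}) (lam : {poly R}) (e : bool) (kappa : int).

Let mu := char_poly_mu p nu lam.

(* sum_j mu_{sj} kappa^j p^{jm} *)
Definition mu_row (s m : nat) : R :=
  \sum_(j < size mu`_s) mu`_s`_j * kappa%:~R ^+ j * p%:R ^+ (j * m).

(* [:: b_0; ...; b_(N-1)] *)
Fixpoint bseq (N : nat) : seq R :=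
  if N is n.+1 then
    let l := bseq n in
    rcons l (if n is 0 then 1 else
      - (\sum_(1 <= s < n.+1) mu_row s (n - s) * iter s phi l`_(n - s)) / mu_row 0 n)
  else [::].

Definition bcoef (n : nat) : R := (bseq n.+1)`_n.

Lemma size_bseq N : size (bseq N) = N.
Proof. by elim: N => //= N IHN; rewrite size_rcons IHN. Qed.

Lemma nth_bseq N n : (n < N)%N -> (bseq N)`_n = bcoef n.
Proof.
elim: N => // N IHN; rewrite ltnS leq_eqVlt => /predU1P[->//|ltnN].
by rewrite -IHN //= nth_rcons size_bseq ltnN.
Qed.

Lemma bcoef0 : bcoef 0 = 1.
Proof. by []. Qed.

Lemma bcoefS n : bcoef n.+1 =
  - (\sum_(1 <= s < n.+2) mu_row s (n.+1 - s) * iter s phi (bcoef (n.+1 - s)))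
    / mu_row 0 n.+1.
Proof.
rewrite {1}/bcoef; set N := n.+1.
have -> : bseq N.+1 = rcons (bseq N) (- (\sum_(1 <= s < N.+1)
  mu_row s (N - s) * iter s phi (bseq N)`_(N - s)) / mu_row 0 N) by [].
rewrite nth_rcons size_bseq ltnn eqxx; congr (- _ / _).
rewrite !big_nat; apply: eq_bigr => s /andP[s_gt0 _].
by rewrite nth_bseq // ltn_subrL s_gt0.
Qed.

Definition qseries_exp (K : fieldType) (f : {qseries e, K}) : {qseries e, K} :=
  QSeries e (fun i => \sum_(n < i.+1) qcoef (f ^+ n) i / n`!%:R).

(* The sum over n of b_n phi^n(alpha) q^(kappa p^n) / (kappa p^n), over Frac(R):
   as n < p^n <= |kappa p^n|, the inner sum meets every monomial. *)
Definition log_basic (alpha : R) : {qseries e, {fraction R}} :=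
  QSeries e (fun i => \sum_(n < i.+1 | kappa * p%:Z ^+ n == qexp e i)
    tofrac (bcoef n * iter n phi alpha) / (kappa * p%:Z ^+ n)%:~R).

Definition basic (alpha : R) : {qseries e, R} :=
  QSeries e (fun i => descend (qcoef (qseries_exp (log_basic alpha)) i)).

End BasicSeries.

Arguments basic p {R} phi nu lam e kappa alpha.

Section Convolution.
Variables (p : nat) (R : idomainType).

(* The group ring of the roots of unity of R. *)
Record Zmu := {
  Zmu_coef :> {fsfun R -> int with 0};
  Zmu_supp : forall z, z \in finsupp Zmu_coef ->
    exists2 n : nat, (0 < n)%N & z ^+ n = 1 }.

(* An element of the p-adic completion lim_n Zmu / p^n Zmu, through
   representatives of its components. *)
Record Zmu_hat := {
  Zmu_rep :> nat -> Zmu;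
  Zmu_coherent : forall n z, (p%:Z ^+ n %| Zmu_rep n.+1 z - Zmu_rep n z)%Z }.

Definition Zmu_eval (kappa : int) (f : Zmu) : R :=
  \sum_(z <- finsupp f) (f z)%:~R * z ^ kappa.

Definition Zmu_hat_eval (kappa : int) (f : Zmu_hat) : R :=
  plim p (fun n => Zmu_eval kappa (f n)).

Variable e : bool.

(* u(zq) *)
Definition qdilate (z : R) (u : {qseries e, R}) : {qseries e, R} :=
  QSeries e (fun n => z ^ qexp e n * qcoef u n).

Definition Zmu_act (f : Zmu) (u : {qseries e, R}) : {qseries e, R} :=
  \prod_(z <- finsupp f) qdilate z u ^ f z.

(* The limit is coefficientwise: if u(0) = 1, the powers u^(p^n) tend to 1
   coefficientwise, but not uniformly. *)
Definition Zmu_hat_act (f : Zmu_hat) (u : {qseries e, R}) : {qseries e, R} :=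
  qlim p (fun n => Zmu_act (f n) u).

End Convolution.

Section Solutions.
Variables (p : nat) (R : idomainType) (phi : R -> R).
Variables (nu : {poly {poly R}}) (lam : {poly R}) (e : bool).

Definition U_ : set {qseries e, R} :=
  [set u | qcoef u 0 = 1 /\ psi p phi nu lam u = 0].

Definition Ukappa (kappa : int) : set {qseries e, R} :=
  range (basic p phi nu lam e kappa).

(* The action of R on Ukappa induced by Zmu_hat ->> R, f |-> sum f(z) z^kappa. *)
Definition star_kappa (kappa : int) (beta : R) (w : {qseries e, R}) :
    {qseries e, R} :=
  xget 1 [set v | exists2 f : Zmu_hat p R,
    Zmu_hat_eval kappa f = beta & v = Zmu_hat_act f w].

(* The direct sum of these actions, on the direct product of the Ukappa. *)
Definition star (beta : R) (u : {qseries e, R}) : {qseries e, R} :=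
  xget 1 [set v | exists w : int -> {qseries e, R},
    [/\ forall kappa, kappa \in K_ p nu lam e -> Ukappa kappa (w kappa),
        u = \prod_(kappa <- K_ p nu lam e) w kappa
      & v = \prod_(kappa <- K_ p nu lam e) star_kappa kappa beta (w kappa)]].

(* The coefficient of q^kappa in psi_q u. *)
Definition B0 (u : {qseries e, R}) (kappa : int) : R :=
  if kappa == qexp e `|kappa|%N then qcoef (psi_q u) `|kappa|%N else 0.

Definition B0_pm (u : {qseries e, R}) : {ffun K_ p nu lam e -> R^o} :=
  [ffun kappa => B0 u (val kappa)].

End Solutions.

Arguments U_ p {R} phi nu lam e.
Arguments Ukappa p {R} phi nu lam e kappa.
Arguments star p {R} phi nu lam {e} beta u.
Arguments B0 {R e} u kappa.
Arguments B0_pm p {R} nu lam {e} u.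

Record is_mult_module (R : nzRingType) (G : comUnitRingType) (U : set G)
    (act : R -> G -> G) : Prop := {
  mmod_unit : forall u, U u -> u \is a GRing.unit;
  mmod_1 : U 1;
  mmod_M : forall u v, U u -> U v -> U (u * v);
  mmod_V : forall u, U u -> U u^-1;
  mmod_act : forall a u, U u -> U (act a u);
  mmod_actM : forall a u v, U u -> U v -> act a (u * v) = act a u * act a v;
  mmod_actD : forall a b u, U u -> act (a + b) u = act a u * act b u;
  mmod_actA : forall a b u, U u -> act (a * b) u = act a (act b u);
  mmod_act1 : forall u, U u -> act 1 u = u }.

Record is_mult_module_iso (R : nzRingType) (G : comUnitRingType) (U : set G)
    (act : R -> G -> G) (M : lmodType R) (f : G -> M) : Prop := {
  miso_M : forall u v, U u -> U v -> f (u * v) = f u + f v;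
  miso_act : forall a u, U u -> f (act a u) = a *: f u;
  miso_bij : set_bij U setT f }.

(* Main.v *)
Require Import Defs.
From HB Require Import structures.
From mathcomp Require Import all_boot all_order all_algebra fraction.
From mathcomp Require Import finmap.
From mathcomp Require Import boolp classical_sets functions cardinality.
From mathcomp Require Import cyclic finfield ring.

Set Implicit Arguments.
Unset Strict Implicit.
Unset Printing Implicit Defensive.

Import Order.TTheory GRing.Theory Num.Theory.
Local Open Scope ring_scope.

(* Let x_N be the exponent of the N-th monomial, c = psi_q u and T = qphi.  One has
   delta_q (psi_p u) = T c - c, so that psi u = 0 amounts to the linear recursion
     sum_s mu_s(x_(N/p^s)) phi^s (c_(N/p^s)) = 0   for all N,
   where mu_s is the coefficient of xi_p^s in mu.  The only free entries of c are
   those whose exponent lies in K, hence the injectivity of B^0.  Conversely,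
   lambda(0) being a unit, T c - c is in the image of delta_q for every solution
   c, and Dwork's lemma integrates c to some u with psi_q u = c; applied to
   c = sum_n b_n phi^n(alpha) q^(kappa p^n) this gives the integrality of the
   basic series.  As phi acts on roots of unity by z |-> z^p (here p != 2 is
   used), convolution by f multiplies alpha by f(kappa), and these values exhaust
   R by Teichmuller expansions. *)

(** * Power series and logarithmic derivatives *)

(** With constant term 1 and in characteristic 0, [u] is determined by [psi_q u], so passing to
    logarithmic derivatives turns products into sums without loss. The price is integrality: [u] is
    recovered from [c] by dividing by exponents, and this is what Dwork's lemma controls. The
    entries of [c] on K are really free because characteristic integers are prime to p: at such an
    order the terms with s > 0 vanish, and the term s = 0 has coefficient 0. The action [star] is
    specified through choices, of an f with f(kappa) = beta and of a factorization of [u] into basic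
    series, and neither may matter. For the first, f acts on a basic series through f(kappa) alone.
    This passes from the group ring to its completion by a continuity argument in which coefficient
    N may lose N powers of p, which is harmless as limits are taken coefficient by coefficient. For
    the second, B^0 reads the parameters off any factorization. Identities between elements of U can
    then be tested on B^0. *)

Section SeriesRing.
Variables (e : bool) (A : comNzRingType).
Implicit Types u v w : {qseries e, A}.

Lemma qcoef_mulrn u k n : qcoef (u *+ k) n = qcoef u n *+ k.
Proof. by elim: k => [|k IHk]; rewrite ?mulr0n // !mulrS qcoefD IHk. Qed.

Lemma qscaleAl (a : A) u v : a *: u * v = a *: (u * v).
Proof.
apply: qseriesP => n; rewrite qcoefZ !qcoefM mulr_sumr.
by apply: eq_bigr => i _; rewrite qcoefZ mulrA.
Qed.

Lemma qscaleX (a : A) u n : (a *: u) ^+ n = a ^+ n *: u ^+ n.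
Proof.
elim: n => [|n IHn]; first by rewrite !expr0 scale1r.
rewrite !exprS IHn qscaleAl [X in _ *: X]mulrC qscaleAl scalerA.
by rewrite (mulrC u).
Qed.

Lemma qcoefM0 u v : qcoef (u * v) 0 = qcoef u 0 * qcoef v 0.
Proof. by rewrite qcoefM big_ord1. Qed.

Lemma qcoefX0 u k : qcoef (u ^+ k) 0 = qcoef u 0 ^+ k.
Proof. by elim: k => [|k IHk]; rewrite ?expr0 // !exprS qcoefM0 IHk. Qed.

Lemma eq_qcoefM u u' v v' n :
  (forall i, (i <= n)%N -> qcoef u i = qcoef u' i) ->
  (forall i, (i <= n)%N -> qcoef v i = qcoef v' i) ->
  qcoef (u * v) n = qcoef (u' * v') n.
Proof.
move=> eu ev; rewrite !qcoefM; apply: eq_bigr => -[i /=];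
  rewrite ltnS => lein _.
by rewrite eu // ev // leq_subr.
Qed.

(** Replaces series by truncations, so that composition with ['X^p] and the Frobenius endomorphism
    of a polynomial ring become available. *)
Lemma qcoefM_poly (s t : {poly A}) u v n :
    (forall i, (i <= n)%N -> s`_i = qcoef u i) ->
    (forall i, (i <= n)%N -> t`_i = qcoef v i) ->
  (s * t)`_n = qcoef (u * v) n.
Proof.
move=> hs ht; rewrite coefM qcoefM; apply: eq_bigr => -[i /=].
by rewrite ltnS => lein _; rewrite hs // ht // leq_subr.
Qed.

Lemma qcoefX_poly (s : {poly A}) u k n :
    (forall i, (i <= n)%N -> s`_i = qcoef u i) ->
  (s ^+ k)`_n = qcoef (u ^+ k) n.
Proof.
elim: k n => [|k IHk] n hs; first by rewrite !expr0 coef1 qcoef1.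
rewrite !exprS; apply: qcoefM_poly => // i lein; apply: IHk => j leji.
by rewrite hs // (leq_trans leji).
Qed.

Lemma qcoef_poly u n i : (i <= n)%N ->
  (\poly_(j < n.+1) qcoef u j)`_i = qcoef u i.
Proof. by move=> lein; rewrite coef_poly ltnS lein. Qed.

End SeriesRing.

Lemma qexpD e i j : qexp e (i + j) = qexp e i + qexp e j.
Proof. by rewrite /qexp PoszD mulrDr. Qed.

Lemma qexpM e i j : qexp e (i * j) = qexp e i * j%:Z.
Proof. by rewrite /qexp PoszM mulrA. Qed.

Lemma qexp0 e : qexp e 0 = 0.
Proof. exact: mulr0. Qed.

Section QDerivation.
Variables (e : bool) (R : idomainType).
Implicit Types u v w : {qseries e, R}.

Fact delta_q_is_zmod_morphism : zmod_morphism (@delta_q R e).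
Proof.
by move=> u v; apply: qseriesP => n; rewrite /= mulrDr mulrN.
Qed.

HB.instance Definition _ := GRing.isZmodMorphism.Build
  {qseries e, R} {qseries e, R} (@delta_q R e) delta_q_is_zmod_morphism.

Lemma delta_qD u v : delta_q (u + v) = delta_q u + delta_q v.
Proof. exact: raddfD. Qed.

Lemma delta_qMn u n : delta_q (u *+ n) = delta_q u *+ n.
Proof. exact: raddfMn. Qed.

Lemma qcoef_delta_q u n : qcoef (delta_q u) n = (qexp e n)%:~R * qcoef u n.
Proof. by []. Qed.

Lemma delta_qZ a u : delta_q (a *: u) = a *: delta_q u.
Proof. by apply: qseriesP => n; rewrite /= mulrCA. Qed.

Lemma delta_qM u v : delta_q (u * v) = delta_q u * v + u * delta_q v.
Proof.
apply: qseriesP => n; rewrite [LHS]/= qcoefD !qcoefM mulr_sumr -big_split /=.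
apply: eq_bigr => -[i /=]; rewrite ltnS => lein _.
have -> : qexp e n = qexp e i + qexp e (n - i) by rewrite -qexpD subnKC.
by rewrite intrD; ring.
Qed.

Lemma delta_q1 : delta_q 1 = 0 :> {qseries e, R}.
Proof.
by apply: qseriesP => -[|n]; rewrite /= ?qexp0 ?mul0r ?mulr0.
Qed.

Lemma delta_qX u n : delta_q (u ^+ n.+1) = (u ^+ n * delta_q u) *+ n.+1.
Proof.
elim: n => [|n IHn]; first by rewrite !expr1 expr0 mul1r.
by rewrite exprS delta_qM IHn mulrnAr mulrA -exprS [in RHS]mulrS (mulrC
  (delta_q u)).
Qed.

Lemma qcoef_delta_q0 u : qcoef (delta_q u) 0 = 0.
Proof. by rewrite /= qexp0 mul0r. Qed.

Lemma psi_qK u : u \is a GRing.unit -> psi_q u * u = delta_q u.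
Proof. by move=> uU; rewrite /psi_q divrK. Qed.

Lemma psi_q_eq u c : u \is a GRing.unit -> delta_q u = c * u -> psi_q u = c.
Proof. by move=> uU; rewrite /psi_q => ->; rewrite mulrK. Qed.

Lemma psi_qM u v : u \is a GRing.unit -> v \is a GRing.unit ->
  psi_q (u * v) = psi_q u + psi_q v.
Proof.
move=> uU vU; apply: psi_q_eq; first by rewrite unitrM uU.
by rewrite delta_qM -!psi_qK //; ring.
Qed.

Lemma psi_q1 : psi_q 1 = 0 :> {qseries e, R}.
Proof. by rewrite /psi_q delta_q1 mul0r. Qed.

Lemma psi_qV u : u \is a GRing.unit -> psi_q u^-1 = - psi_q u.
Proof.
move=> uU; apply/eqP; rewrite -addr_eq0 -psi_qM ?unitrV //.
by rewrite mulVr // psi_q1.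
Qed.

Lemma psi_qXz u (k : int) : u \is a GRing.unit -> psi_q (u ^ k) = psi_q u *~ k.
Proof.
move=> uU; have psi_qX n : psi_q (u ^+ n) = psi_q u *+ n.
  elim: n => [|n IHn]; first by rewrite expr0 psi_q1.
  by rewrite exprS psi_qM ?unitrX // IHn mulrS.
case: k => n; first exact: psi_qX.
by rewrite NegzE -exprnN psi_qV ?unitrX // psi_qX mulrNz.
Qed.

Lemma psi_q_prod (I : eqType) (r : seq I) (F : I -> {qseries e, R}) :
  (forall i, i \in r -> F i \is a GRing.unit) ->
  psi_q (\prod_(i <- r) F i) = \sum_(i <- r) psi_q (F i).
Proof.
elim: r => [|i r IHr] FU; first by rewrite !big_nil psi_q1.
have FrU j : j \in r -> F j \is a GRing.unit.
  by move=> jr; rewrite FU // inE jr orbT.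
rewrite !big_cons psi_qM ?IHr ?FU ?mem_head // big_seq.
by apply: rpred_prod => j /FrU.
Qed.

Lemma qunitE u : (u \is a GRing.unit) = (qcoef u 0 \is a GRing.unit).
Proof. by []. Qed.

Lemma qunit1 u : qcoef u 0 = 1 -> u \is a GRing.unit.
Proof. by rewrite qunitE => ->; apply: unitr1. Qed.

Lemma qcoef0V u : qcoef u 0 = 1 -> qcoef u^-1 0 = 1.
Proof.
move=> u0; have /(congr1 (fun w : {qseries e, R} => qcoef w 0)) :=
  mulrV (qunit1 u0).
by rewrite qcoefM0 u0 mul1r.
Qed.

Lemma qcoef_psi_q0 u : qcoef (psi_q u) 0 = 0.
Proof. by rewrite /psi_q qcoefM0 qcoef_delta_q0 mul0r. Qed.

Section CharZero.
Hypothesis natR_neq0 : forall n, (0 < n)%N -> n%:R != 0 :> R.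

Lemma qexp_neq0 n : (0 < n)%N -> (qexp e n)%:~R != 0 :> R.
Proof.
move=> n_gt0; rewrite /qexp intrM intr_sign mulf_neq0 ?signr_eq0 //.
exact: natR_neq0.
Qed.

(** As c_0 = 0, coefficient n of [c * u] involves only the coefficients of [u] below n, while that
    of [delta_q u] is u_n times a nonzero integer. The truncated form serves approximate
    solutions. *)
Lemma eq_qcoef_qlog c d u v N : qcoef c 0 = 0 -> qcoef u 0 = qcoef v 0 ->
    (forall i, (i <= N)%N -> qcoef c i = qcoef d i) ->
    delta_q u = c * u -> delta_q v = d * v ->
  forall i, (i <= N)%N -> qcoef u i = qcoef v i.
Proof.
move=> c0 uv0 cd Du Dv n; elim/ltn_ind: n => -[|n] IHn //= lenN.
have d0 : qcoef d 0 = 0 by rewrite -cd.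
apply: (mulfI (qexp_neq0 (ltn0Sn n))); rewrite -!qcoef_delta_q Du Dv !qcoefM.
apply: eq_bigr => -[[|i] /= ltin] _; first by rewrite c0 d0 !mul0r.
rewrite cd ?(leq_trans _ lenN) // IHn // subSS ?ltnS ?leq_subr //.
exact: leq_trans (leq_subr _ _) (ltnW lenN).
Qed.

Lemma qlog_eq_inj c u v : qcoef c 0 = 0 -> qcoef u 0 = qcoef v 0 ->
  delta_q u = c * u -> delta_q v = c * v -> u = v.
Proof.
move=> c0 uv0 Du Dv; apply: qseriesP => n.
exact: (eq_qcoef_qlog (N := n) c0 uv0 _ Du Dv).
Qed.

Lemma psi_q_inj u v : qcoef u 0 = 1 -> qcoef v 0 = 1 -> psi_q u = psi_q v ->
  u = v.
Proof.
move=> u0 v0 uv; apply: (@qlog_eq_inj (psi_q u)); rewrite ?qcoef_psi_q0 ?u0 //.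
  by rewrite psi_qK // qunit1.
by rewrite uv psi_qK // qunit1.
Qed.

End CharZero.
End QDerivation.

(** * Divisibility by powers of p *)

Lemma descend_tofrac (R : idomainType) (a : R) : descend (tofrac a) = a.
Proof. by apply: xget_unique => //= b /eqP; rewrite tofrac_eq => /eqP. Qed.

Section PadicRing.
Variables (p : nat) (R : idomainType).

Lemma pdvd0 k : pdvd p k (0 : R).
Proof. by exists 0; rewrite mulr0. Qed.

Lemma pdvdD k (x y : R) : pdvd p k x -> pdvd p k y -> pdvd p k (x + y).
Proof. by move=> [a ->] [b ->]; exists (a + b); rewrite mulrDr. Qed.

Lemma pdvdN k (x : R) : pdvd p k x -> pdvd p k (- x).
Proof. by move=> [a ->]; exists (- a); rewrite mulrN. Qed.

Lemma pdvdB k (x y : R) : pdvd p k x -> pdvd p k y -> pdvd p k (x - y).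
Proof. by move=> px /pdvdN; apply: pdvdD. Qed.

Lemma pdvdMl k (x y : R) : pdvd p k y -> pdvd p k (x * y).
Proof. by move=> [a ->]; exists (x * a); rewrite mulrCA. Qed.

Lemma pdvdMr k (x y : R) : pdvd p k x -> pdvd p k (x * y).
Proof. by rewrite mulrC; apply: pdvdMl. Qed.

Lemma pdvdM j k (x y : R) : pdvd p j x -> pdvd p k y -> pdvd p (j + k) (x * y).
Proof. by move=> [a ->] [b ->]; exists (a * b); rewrite exprD; ring. Qed.

Lemma pdvd_pX k : pdvd p k (p%:R ^+ k : R).
Proof. by exists 1; rewrite mulr1. Qed.

Lemma pdvd_leq j k (x : R) : (j <= k)%N -> pdvd p k x -> pdvd p j x.
Proof.
by move=> lejk [a ->]; exists (p%:R ^+ (k - j) * a);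
  rewrite mulrA -exprD subnKC.
Qed.

Lemma pdvd_sum k (I : Type) (r : seq I) (P : pred I) (F : I -> R) :
  (forall i, P i -> pdvd p k (F i)) -> pdvd p k (\sum_(i <- r | P i) F i).
Proof.
by move=> pF; apply: big_ind => //; [apply: pdvd0 | apply: pdvdD].
Qed.

Lemma pdvd_subX k (x y : R) n : pdvd p k (x - y) -> pdvd p k (x ^+ n - y ^+ n).
Proof. by rewrite subrXX; apply: pdvdMr. Qed.

Hypotheses (p_prime : prime p) (R_ur : is_completed_Zp_ur p R).

Lemma plim_eq (s : nat -> R) l :
  (forall k, exists N, forall n, (N <= n)%N -> pdvd p k (s n - l)) ->
    plim p s = l.
Proof.
move=> sl; apply: xget_unique => //= l' sl'.
apply/eqP; rewrite -subr_eq0; apply/eqP/(Zp_ur_separated R_ur) => k.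
have [N sN] := sl k; have [N' sN'] := sl' k.
have -> : l' - l = (s (maxn N N') - l) - (s (maxn N N') - l') by ring.
by apply: pdvdB; [apply: sN | apply: sN']; rewrite leq_max leqnn ?orbT.
Qed.

Lemma plim_const (s : nat -> R) l N :
  (forall n, (N <= n)%N -> s n = l) -> plim p s = l.
Proof.
by move=> sl; apply: plim_eq => k; exists N => n /sl ->; rewrite subrr;
  apply: pdvd0.
Qed.

Lemma pdvd_limit (s : nat -> R) : (forall n, pdvd p n (s n.+1 - s n)) ->
  exists2 l, plim p s = l & forall k n, (k <= n)%N -> pdvd p k (s n - l).
Proof.
move=> /(Zp_ur_complete R_ur) [l sl];
  have sl' k n : (k <= n)%N -> pdvd p k (s n - l).
  by move=> lekn; apply: pdvd_leq lekn _; rewrite -opprB; apply: pdvdN.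
by exists l => //; apply: plim_eq => k; exists k; apply: sl'.
Qed.

(** An inverse x' modulo p gives x x' = 1 - p t, and the geometric series of p t converges. *)
Lemma unit_modp (x : R) : ~ pdvd p 1 x -> x \is a GRing.unit.
Proof.
move=> px; have [k [red [red_surj redP _]]] := Zp_ur_residue R_ur.
have redx : red x != 0 by apply/eqP => /redP.
have [x' redx'] := red_surj (red x)^-1.
have /redP[t /esym] : red (1 - x * x') = 0.
  by rewrite rmorphB rmorphM rmorph1 /= redx' divff // subrr.
rewrite expr1 => Ext.
have [n|l _ sl] := @pdvd_limit (fun n => \sum_(i < n) (p%:R * t) ^+ i).
  by rewrite big_ord_recr /= addrAC subrr add0r exprMn; apply/pdvdMr/pdvd_pX.
apply/unitrPr; exists (x' * l); rewrite mulrA.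
apply/eqP; rewrite -subr_eq0; apply/eqP/(Zp_ur_separated R_ur) => n.
have -> : x * x' = 1 - p%:R * t by rewrite Ext opprB addrC subrK.
have -> : (1 - p%:R * t) * l - 1 =
    - ((1 - p%:R * t) * (\sum_(i < n) (p%:R * t) ^+ i - l)) - (p%:R * t) ^+ n.
  move: (subrX1 (p%:R * t) n); set a := p%:R * t; set S := \sum_(i < n) _.
  by move=> E; have -> : a ^+ n = 1 + (a - 1) * S by [rewrite -E addrC subrK];
    ring.
apply: pdvdB; first by apply/pdvdN/pdvdMl/sl.
by rewrite exprMn; apply/pdvdMr/pdvd_pX.
Qed.

Lemma pdvd_nunit (x : R) : x \is a GRing.unit -> ~ pdvd p 1 x.
Proof.
move=> xU px; have [k [red [_ redP _]]] := Zp_ur_residue R_ur.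
by have := rmorph_unit red xU; have /redP -> := px; rewrite unitr0.
Qed.

Lemma unit_pdvd_sub (x y : R) : x \is a GRing.unit -> pdvd p 1 (x - y) ->
  y \is a GRing.unit.
Proof.
move=> xU pxy; apply: unit_modp => py; apply: (pdvd_nunit xU).
by rewrite -[x](subrK y); apply: pdvdD.
Qed.

Lemma pdvd_nat n : (p %| n)%N -> pdvd p 1 (n%:R : R).
Proof. by move=> /dvdnP[m ->]; exists m%:R; rewrite natrM mulrC. Qed.

Lemma natr_unit n : ~~ (p %| n)%N -> n%:R \is a @GRing.unit R.
Proof.
move=> pNn; apply: unit_modp => pn; have n_gt0 : (0 < n)%N by rewrite lt0n;
  apply: contraNneq pNn => ->.
have : coprime n p by rewrite coprime_sym prime_coprime.
case: (egcdnP p n_gt0) => a b Eab _; rewrite /coprime => /eqP gcd1.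
have : pdvd p 1 (1 : R).
  have -> : 1 = a%:R * n%:R - (b * p)%:R :> R.
    by rewrite -natrM Eab gcd1 natrD addrC addKr.
  by apply: pdvdB; [apply: pdvdMl | apply: pdvd_nat; rewrite dvdn_mull].
by apply: pdvd_nunit; apply: unitr1.
Qed.

Lemma natr_neq0 n : (0 < n)%N -> n%:R != 0 :> R.
Proof.
move=> n_gt0; rewrite -(partnC p n_gt0) natrM mulf_neq0 //.
  by rewrite p_part natrX expf_neq0 // (Zp_ur_p_neq0 R_ur).
have mU : (n`_p^')%:R \is a @GRing.unit R.
  by apply: natr_unit; rewrite -p'natE // part_pnat.
by apply: contraTneq mU => ->; rewrite unitr0.
Qed.

(** The p-adic valuation of n is at most n - 1; this makes the coefficients of the logarithm series
    in [psi_p] integral. *)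
Lemma pX_over_natr n : (0 < n)%N -> exists a : R, n%:R * a = p%:R ^+ n.-1.
Proof.
move=> n_gt0; set m := (n`_p^')%N.
have mU : m%:R \is a @GRing.unit R.
  by apply: natr_unit; rewrite -p'natE // part_pnat.
exists (p%:R ^+ (n.-1 - logn p n) / m%:R).
rewrite -[in n%:R](partnC p n_gt0) -/m natrM p_part natrX mulrACA mulrV //
  mulr1.
by rewrite -exprD subnKC // -ltnS prednK // ltn_logl.
Qed.

Lemma pX_cancel k (x y : R) : p%:R ^+ k * x = p%:R ^+ k * y -> x = y.
Proof. by apply: mulfI; rewrite expf_neq0 // natr_neq0 // prime_gt0. Qed.

Lemma pdvd_cancel j k (x : R) : pdvd p (j + k) (p%:R ^+ j * x) -> pdvd p k x.
Proof.
by case=> y; rewrite exprD -mulrA => /pX_cancel ->; exists y.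
Qed.

(** The valuation of n is bounded crudely by n, which suffices for coefficientwise limits. *)
Lemma pdvd_cancel_nat k n (x : R) : (0 < n)%N ->
  pdvd p (n + k) (n%:R * x) -> pdvd p k x.
Proof.
move=> n_gt0 H; have lt_v : (logn p n <= n)%N by rewrite ltnW // ltn_logl.
move: H => /(pdvd_leq (leq_add lt_v (leqnn k))).
rewrite -[in n%:R](partnC p n_gt0); set m := (n`_p^')%N.
have mU : m%:R \is a @GRing.unit R.
  by apply: natr_unit; rewrite -p'natE // part_pnat.
rewrite p_part natrM natrX -mulrA => /pdvd_cancel.
by move=> /(pdvdMl m%:R^-1); rewrite mulKr.
Qed.

End PadicRing.

(** * The Frobenius lift on power series *)

Section Frobenius.
Variables (p : nat) (R : idomainType) (phi : {rmorphism R -> R}) (e : bool).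
Implicit Types u v w c : {qseries e, R}.

Fact qphi_is_zmod_morphism : zmod_morphism (@qphi p R phi e).
Proof.
move=> u v; apply: qseriesP => n; rewrite /=.
by case: ifP; rewrite ?rmorphB ?subr0.
Qed.

HB.instance Definition _ := GRing.isZmodMorphism.Build
  {qseries e, R} {qseries e, R} (@qphi p R phi e) qphi_is_zmod_morphism.

Lemma qcoef_qphi u n : qcoef (qphi p phi u) n =
  if (p %| n)%N then phi (qcoef u (n %/ p)) else 0.
Proof. by []. Qed.

Lemma qcoef_qphi0 u : qcoef (qphi p phi u) 0 = phi (qcoef u 0).
Proof. by rewrite /= dvdn0 div0n. Qed.

Lemma delta_q_qphi u : delta_q (qphi p phi u) = qphi p phi (delta_q u) *+ p.
Proof.
apply: qseriesP => n; rewrite qcoef_mulrn /=; case: ifP => [pn|_]; last first.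
  by rewrite mulr0 mul0rn.
rewrite [in RHS]rmorphM [in RHS]rmorph_int -{1}(divnK pn) qexpM intrM -pmulrn.
by rewrite -mulr_natl; ring.
Qed.

Lemma qcoef_iter_qphi s u n : (0 < p)%N ->
  qcoef (iter s (@qphi p R phi e) u) n =
  if (p ^ s %| n)%N then iter s phi (qcoef u (n %/ p ^ s)) else 0.
Proof.
move=> p_gt0; elim: s n => [|s IHs] n; first by rewrite dvd1n divn1.
rewrite iterS [LHS]/= IHs; case: (boolP (p %| n)%N) => [/dvdnP[m ->]|pNn].
  rewrite mulnK // expnSr dvdn_pmul2r // divnMr //.
  by case: ifP => // _; rewrite rmorph0.
case: ifP => // /(dvdn_trans _) pn; case/negP: pNn; apply: pn.
by rewrite expnS dvdn_mulr.
Qed.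

Lemma iter_qphi_raddf s : {morph iter s (@qphi p R phi e) : u v / u - v}.
Proof. by elim: s => // s IHs u v; rewrite !iterS IHs raddfB. Qed.

Lemma delta_q_iter_qphi s u :
  delta_q (iter s (@qphi p R phi e) u) = iter s (@qphi p R phi e) (delta_q u)
    *+ p ^ s.
Proof.
elim: s u => [|s IHs] u; first by rewrite expn0 mulr1n.
by rewrite !iterS delta_q_qphi IHs raddfMn -mulrnA -expnSr.
Qed.

Hypothesis p_prime : prime p.

(** On truncations, [qphi] applies [phi] to the coefficients and then composes with ['X^p]; both are
    multiplicative. *)
Lemma qphiM u v : qphi p phi (u * v) = qphi p phi u * qphi p phi v.
Proof.
have p_gt0 := prime_gt0 p_prime.
pose P w n := \poly_(i < n.+1) phi (qcoef w i).
have P_coef w n i : (i <= n)%N -> (P w n \Po 'X^p)`_i = qcoef (qphi p phi w) i.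
  move=> lein; rewrite coef_comp_poly_Xn // /=; case: ifP => // _.
  by rewrite coef_poly ltnS (leq_trans (leq_div _ _)).
apply: qseriesP => n; rewrite -(qcoefM_poly (P_coef u n) (P_coef v n)).
rewrite -comp_polyM coef_comp_poly_Xn //; rewrite [LHS]/=; case: ifP => // _.
rewrite rmorph_sum coefM; apply: eq_bigr => -[i /=]; rewrite ltnS => lein _.
rewrite rmorphM !coef_poly !ltnS (leq_trans lein (leq_div _ _)).
by rewrite (leq_trans (leq_subr _ _) (leq_div _ _)).
Qed.

Hypotheses (R_ur : is_completed_Zp_ur p R) (phi_frob : lifts_frobenius p phi).

(** Over the residue field the p-th power is a ring endomorphism: it acts on coefficients by
    Frobenius and sends ['X] to ['X^p], just as [qphi] does modulo p. *)
Lemma pdvd_qphi_sub_Xp u n : pdvd p 1 (qcoef (qphi p phi u - u ^+ p) n).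
Proof.
have [k [red [_ redP _]]] := Zp_ur_residue R_ur.
have pk : p \in [pchar k].
  by rewrite inE p_prime -(rmorph_nat red); apply/eqP/redP/pdvd_nat.
have pPk : p \in [pchar {poly k}] by rewrite pchar_poly.
apply/redP; rewrite qcoefD qcoefN rmorphB /=; apply/eqP; rewrite subr_eq0;
  apply/eqP.
rewrite -(qcoefX_poly (n := n) p (s := \poly_(i < n.+1) qcoef u i)); last first.
  by move=> i; apply: qcoef_poly.
rewrite -coef_map rmorphXn /= -(pFrobenius_autE pPk) poly_def !rmorph_sum /=
  coef_sum.
under eq_bigr => i _.
  rewrite map_polyZ /= map_polyXn pFrobenius_autE exprZn -exprM coefZ coefXn.
  rewrite -rmorphXn /=; over.
case: ifP => [/dvdnP[m ->]|pNn].
  have lemn : (m < (m * p).+1)%N by rewrite ltnS leq_pmulr // prime_gt0.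
  rewrite mulnK ?prime_gt0 // (bigD1 (Ordinal lemn)) //= eqxx mulr1 big1 ?addr0.
    have /redP := phi_frob (qcoef u m).
    by rewrite rmorphB => /eqP; rewrite subr_eq0 => /eqP.
  move=> i im; rewrite eqn_pmul2r ?prime_gt0 // eq_sym.
  by rewrite (_ : (i == m :> nat) = false) ?mulr0 //; apply: negbTE.
rewrite rmorph0 big1 // => i _; case: eqP => [ni|]; rewrite ?mulr0 //.
by rewrite ni dvdn_mull in pNn.
Qed.

Lemma delta_pE u : delta_p p phi u *+ p = qphi p phi u - u ^+ p.
Proof.
apply: qseriesP => n; rewrite qcoef_mulrn.
change (qcoef (delta_p p phi u) n) with
  (descend (tofrac (qcoef (qphi p phi u - u ^+ p) n) / p%:R)).
have [y] := pdvd_qphi_sub_Xp u n; rewrite expr1 => ->.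
rewrite rmorphM rmorph_nat mulrC mulKf ?descend_tofrac ?mulr_natl //.
by rewrite -(rmorph_nat (@tofrac R)) tofrac_eq0 (natr_neq0 p_prime R_ur)
  ?prime_gt0.
Qed.

Lemma qcoef_delta_p0 u : qcoef u 0 = 1 -> qcoef (delta_p p phi u) 0 = 0.
Proof.
move=> u0; have /(congr1 (fun w : {qseries e, R} => qcoef w 0)) := delta_pE u.
rewrite qcoef_mulrn qcoefD qcoefN qcoef_qphi0 qcoefX0 u0 rmorph1 expr1n subrr.
by rewrite -mulr_natr => /eqP; rewrite mulf_eq0 (negPf (natr_neq0 p_prime R_ur
  (prime_gt0 p_prime))) orbF => /eqP.
Qed.

Definition log_coef n : R := descend ((-1) ^+ n.-1 * p%:R ^+ n.-1 / n%:R).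

Lemma log_coefE n : (0 < n)%N -> n%:R * log_coef n = (- p%:R) ^+ n.-1.
Proof.
move=> n_gt0; have [a Ea] := pX_over_natr p_prime R_ur n_gt0.
rewrite /log_coef (_ : _ / _ = tofrac ((-1) ^+ n.-1 * a)).
  by rewrite descend_tofrac mulrCA Ea -exprMn mulN1r.
have nF : n%:R != 0 :> {fraction R}.
  by rewrite -(rmorph_nat (@tofrac R)) tofrac_eq0 (natr_neq0 p_prime R_ur).
apply: (mulIf nF); rewrite divfK //.
have toF m : m%:R = tofrac m%:R :> {fraction R} by rewrite rmorph_nat.
rewrite (toF p) (toF n) -(rmorph1 (@tofrac R)) -rmorphN -!(rmorphXn (@tofrac
  R)) -!rmorphM /= -Ea.
by rewrite mulrA mulrAC.
Qed.

(** As [delta_p u] has no constant term, the n-th power in the series starts at order n or later, so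
    at each order the p-adic limit is that of an eventually constant sequence. *)
Lemma qcoef_psi_p u i M : qcoef u 0 = 1 -> (i <= M)%N ->
  qcoef (psi_p p phi u) i =
  qcoef (\sum_(1 <= n < M.+1) log_coef n *: (delta_p p phi u / u ^+ p) ^+ n) i.
Proof.
move=> u0 leiM; rewrite /psi_p [LHS]/=;
  apply: (plim_const R_ur (N := M.+1)) => N ltMN.
rewrite [in LHS](big_cat_nat (n := M.+1)) // qcoefD [X in _ + X]qcoef_sum.
rewrite [X in _ + X]big_nat [X in _ + X]big1 ?addr0 // => n /andP[ltMn _].
rewrite qcoefZ qcoefX_small ?mulr0 //; last exact: leq_ltn_trans ltMn.
by rewrite qcoefM0 qcoef_delta_p0 // mul0r.
Qed.

Lemma qcoef_psi_p0 u : qcoef u 0 = 1 -> qcoef (psi_p p phi u) 0 = 0.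
Proof. by move=> u0; rewrite (qcoef_psi_p u0 (leqnn _)) big_geq. Qed.

(** With w = delta_p u / u^p, [psi_p u] is 1/p log(1 + p w), so its derivative g satisfies (1 + p w)
    g = delta_q w. The rest is the derivative of (1 + p w) u^p = phi_p(u). *)
Lemma delta_q_psi_p u : qcoef u 0 = 1 ->
  delta_q (psi_p p phi u) = qphi p phi (psi_q u) - psi_q u.
Proof.
move=> u0; have uU := qunit1 u0; have p_gt0 := prime_gt0 p_prime.
set w := delta_p p phi u / u ^+ p; set g := delta_q (psi_p p phi u).
have w0 : qcoef w 0 = 0 by rewrite qcoefM0 qcoef_delta_p0 // mul0r.
have Eg : (1 + w *+ p) * g = delta_q w.
  apply: qseriesP => i; pose G := \sum_(1 <= n < i.+2) log_coef n *: w ^+ n.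
  have -> : qcoef ((1 + w *+ p) * g) i = qcoef ((1 + w *+ p) * delta_q G) i.
    apply: eq_qcoefM => // j leji; rewrite /g !qcoef_delta_q; congr (_ * _).
    exact: (qcoef_psi_p u0 (leqW leji)).
  (* Differentiation cancels the denominators n and leaves a geometric series; its remainder has
     order above i. *)
  have -> : delta_q G = \sum_(n < i.+1) (- (w *+ p)) ^+ n * delta_q w.
    rewrite /G big_add1 /= big_mkord raddf_sum /=; apply: eq_bigr => n _.
    rewrite delta_qZ delta_qX -scaler_nat scalerA mulrC log_coefE //= -qscaleAl.
    by rewrite (_ : - (w *+ p) = - p%:R *: w) ?qscaleX // scaleNr scaler_nat.
  rewrite -mulr_suml mulrA.
  have -> : (1 + w *+ p) * \sum_(n < i.+1) (- (w *+ p)) ^+ n =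
      1 - (- (w *+ p)) ^+ i.+1.
    have := subrX1 (- (w *+ p)) i.+1; set a := - (w *+ p) => Ea.
    rewrite -[w *+ p]opprK -/a; apply/eqP;
      rewrite -eqr_opp opprB Ea -mulNr opprB.
    exact/eqP.
  rewrite mulrBl mul1r qcoefD qcoefN [X in _ - X]qcoefM [X in _ - X]big1 ?subr0
    //.
  move=> -[j /= ltji] _; rewrite qcoefX_small ?mul0r //.
  by rewrite qcoefN qcoef_mulrn w0 mul0rn oppr0.
have upU : u ^+ p \is a GRing.unit by rewrite unitrX.
have Ew : (1 + w *+ p) * u ^+ p = qphi p phi u.
  by rewrite mulrDl mul1r mulrnAl /w divrK // delta_pE addrC subrK.
have phiuU : qphi p phi u \is a GRing.unit.
  by apply: qunit1; rewrite qcoef_qphi0 u0 rmorph1.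
(* Differentiating [Ew] produces one factor p in each term: from [w *+ p], from [u ^+ p], and from
   commuting [delta_q] with [qphi]. *)
have : (delta_q w * u ^+ p + (1 + w *+ p) * (u ^+ p * psi_q u)) *+ p =
    (qphi p phi (psi_q u) * qphi p phi u) *+ p.
  rewrite -qphiM psi_qK // -delta_q_qphi -Ew delta_qM delta_qD delta_q1 add0r.
  rewrite delta_qMn mulrnDl -mulrnAl; congr (_ + _); rewrite -mulrnAr;
    congr (_ * _).
  case: (p) p_gt0 => // q _.
  by rewrite delta_qX exprSr -mulrA (mulrC u) psi_qK.
have mulpI (v v' : {qseries e, R}) : v *+ p = v' *+ p -> v = v'.
  move=> vv'; apply: qseriesP => n; have := congr1 (fun w => qcoef w n) vv'.
  rewrite !qcoef_mulrn -[in LHS]mulr_natl -[in RHS]mulr_natl; apply: mulfI.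
  by rewrite (natr_neq0 p_prime R_ur).
move=> /mulpI; rewrite -Eg mulrAC Ew mulrA Ew -mulrDr mulrC =>
  /(mulIr phiuU) <-.
by rewrite addrK.
Qed.

End Frobenius.

(** * The linear recursion *)

Section IterMorphism.
Variables (R : pzRingType) (f : {rmorphism R -> R}).

Lemma iter_rmorphM s : {morph iter s f : x y / x * y}.
Proof. by elim: s => // s IHs x y; rewrite !iterS IHs rmorphM. Qed.

Lemma iter_rmorphB s : {morph iter s f : x y / x - y}.
Proof. by elim: s => // s IHs x y; rewrite !iterS IHs rmorphB. Qed.

Lemma iter_rmorph0 s : iter s f 0 = 0.
Proof. by elim: s => // s IHs; rewrite iterS IHs rmorph0. Qed.

Lemma iter_rmorph_int s (k : int) : iter s f k%:~R = k%:~R.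
Proof. by elim: s => // s IHs; rewrite iterS IHs rmorph_int. Qed.

Lemma iter_rmorphX s n : {morph iter s f : x / x ^+ n}.
Proof. by elim: s => // s IHs x; rewrite !iterS IHs rmorphXn. Qed.

End IterMorphism.

Lemma eq_sum_support (V : nmodType) (F : nat -> V) a b :
  (forall i, (a <= i)%N -> F i = 0) -> (forall i, (b <= i)%N -> F i = 0) ->
  \sum_(i < a) F i = \sum_(i < b) F i.
Proof.
wlog leab : a b / (a <= b)%N => [th|] Fa Fb.
  by case/orP: (leq_total a b) => le_ab; [|symmetry]; apply: th.
rewrite -!(big_mkord xpredT) [RHS](big_cat_nat (n :=
  a)) //= [X in _ = _ + X]big_nat.
by rewrite [X in _ = _ + X]big1 ?addr0 // => i /andP[/Fa].
Qed.

Section LogOperator.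
Variables (p : nat) (R : idomainType) (phi : {rmorphism R -> R}) (e : bool).
Variables (nu : {poly {poly R}}) (lam : {poly R}).
Implicit Types u v w c d : {qseries e, R}.
Local Notation Phi := (@qphi p R phi e).
Local Notation mu := (char_poly_mu p nu lam).

Hypotheses (p_prime : prime p) (R_ur : is_completed_Zp_ur p R).
Hypotheses (phi_frob : lifts_frobenius p phi).

Let p_gt0 : (0 < p)%N := prime_gt0 p_prime.

(* [delta_q \o psi], as an operator on [psi_q u]. *)
Definition log_op c :=
  delta_q (\sum_(i < size nu) \sum_(j < size nu`_i)
     nu`_i`_j *: iter i Phi (iter j (@delta_q R e) c)) +
  \sum_(i < size lam) (lam`_i * p%:R ^+ i) *: iter i Phi (Phi c - c).

Fact log_op_is_zmod_morphism : zmod_morphism log_op.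
Proof.
have iter_delta_qB j : {morph iter j (@delta_q R e) : x y / x - y}.
  by elim: j => // j IHj x y; rewrite !iterS IHj raddfB.
move=> c d.
have subD x y z t : (x + y) - (z + t) = (x - z) + (y - t) :> {qseries e, R}.
  by rewrite opprD addrACA.
rewrite /log_op subD -raddfB /= -!sumrB; congr (delta_q _ + _).
  apply: eq_bigr => i _; rewrite -sumrB; apply: eq_bigr => j _.
  by rewrite iter_delta_qB iter_qphi_raddf scalerBr.
apply: eq_bigr => i _; rewrite -scalerBr -iter_qphi_raddf raddfB /=.
by congr (_ *: iter _ _ _); ring.
Qed.

HB.instance Definition _ := GRing.isZmodMorphism.Build
  {qseries e, R} {qseries e, R} log_op log_op_is_zmod_morphism.

Lemma delta_q_psi u : qcoef u 0 = 1 ->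
  delta_q (psi p phi nu lam u) = log_op (psi_q u).
Proof.
move=> u0; rewrite /psi delta_qD /log_op; congr (_ + _).
rewrite (raddf_sum (@delta_q R e)); apply: eq_bigr => i _ /=;
  rewrite delta_qZ delta_q_iter_qphi.
by rewrite delta_q_psi_p // -scaler_nat scalerA natrX.
Qed.

(** [delta_q] forgets constant terms; this supplies the missing one when psi u = 0 is deduced from
    the vanishing of its derivative. *)
Lemma qcoef_psi0 u : qcoef u 0 = 1 -> qcoef (psi p phi nu lam u) 0 = 0.
Proof.
move=> u0; rewrite qcoefD !qcoef_sum big1 ?add0r => [|i _].
  apply: big1 => i _; rewrite qcoefZ qcoef_iter_qphi // dvdn0 div0n.
  by rewrite qcoef_psi_p0 // iter_rmorph0 mulr0.
rewrite qcoef_sum big1 // => j _; rewrite qcoefZ qcoef_iter_qphi // dvdn0 div0n.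
suff -> : qcoef (iter j (@delta_q R e) (psi_q u)) 0 = 0 by rewrite iter_rmorph0
  mulr0.
by case: (nat_of_ord j) => [|m]; [rewrite qcoef_psi_q0 | rewrite iterS
  qcoef_delta_q0].
Qed.

Lemma char_poly_mu_coef s : mu`_s =
  p%:R ^+ s *: (nu`_s * 'X) +
  ((if s is t.+1 then lam`_t * p%:R ^+ t else 0) - lam`_s * p%:R ^+ s)%:P.
Proof.
have comp_pX (q : {poly {poly R}}) i : (q \Po (p%:R *: 'X))`_i = q`_i * p%:R ^+
  i.
  rewrite comp_polyE coef_sum.
  under eq_bigr => j _ do rewrite exprZn coefZ coefZ coefXn.
  have [lti|gei] := ltnP i (size q).
    rewrite (bigD1 (Ordinal lti)) //= eqxx mulr1 big1 ?addr0 // => j ij.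
    by rewrite eq_sym (_ : (j == i :> nat) = false) ?mulr0 //; apply: negbTE.
  rewrite nth_default // mul0r big1 // => -[j /= ltj] _.
  by rewrite gtn_eqF ?mulr0 // (leq_trans ltj).
rewrite coefD coefMC mulrBr mulr1 coefB coefMX !comp_pX !coef_map /=.
have pE : p%:R = (p%:R : R)%:P by rewrite rmorph_nat.
rewrite pE -!polyC_exp polyCB !polyCM; congr (_ + (_ - _)).
- by rewrite -mul_polyC mulrA (mulrC nu`_s).
- by case: s => //= s; rewrite polyCM.
Qed.

End LogOperator.

Section LogOperatorTheory.
Variables (p : nat) (R : idomainType) (phi : {rmorphism R -> R}) (e : bool).
Variables (nu : {poly {poly R}}) (lam : {poly R}).
Implicit Types u v w c d : {qseries e, R}.
Local Notation Phi := (@qphi p R phi e).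
Local Notation mu := (char_poly_mu p nu lam).
Local Notation log_op := (@log_op p R phi e nu lam).

Hypotheses (p_prime : prime p) (R_ur : is_completed_Zp_ur p R).
Hypotheses (phi_frob : lifts_frobenius p phi).

Let p_gt0 : (0 < p)%N := prime_gt0 p_prime.

Lemma mu_horner s x : (mu`_s).[x] = p%:R ^+ s * (nu`_s).[x] * x +
  ((if s is t.+1 then lam`_t * p%:R ^+ t else 0) - lam`_s * p%:R ^+ s).
Proof. by rewrite char_poly_mu_coef hornerD hornerZ hornerMX hornerC mulrA. Qed.

Lemma iter_delta_q j c n :
  qcoef (iter j (@delta_q R e) c) n = (qexp e n)%:~R ^+ j * qcoef c n.
Proof.
elim: j => [|j IHj]; first by rewrite expr0 mul1r.
by rewrite iterS qcoef_delta_q IHj exprS mulrA.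
Qed.

Lemma qexp_divn s n : (p ^ s %| n)%N ->
  (qexp e n)%:~R = p%:R ^+ s * (qexp e (n %/ p ^ s))%:~R :> R.
Proof.
move=> psn; rewrite -{1}(divnK psn) qexpM intrM mulrC.
by rewrite -pmulrn natrX.
Qed.

(** If p^s divides n and x is the exponent at n / p^s, the exponent at n is p^s x. The outer
    [delta_q] thus yields both the substitution of p xi_p and the factor xi_q in the nu-part of
    mu. *)
Lemma qcoef_log_op c n : (0 < n)%N -> qcoef (log_op c) n =
  \sum_(s < n.+1) (mu`_s).[(qexp e (n %/ p ^ s))%:~R] * qcoef (iter s Phi c) n.
Proof.
move=> n_gt0; pose x s : R := (qexp e (n %/ p ^ s))%:~R.
pose T s := qcoef (iter s Phi c) n.
have T0 s : (n < s)%N -> T s = 0.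
  move=> ltns; rewrite /T qcoef_iter_qphi // gtnNdvd //.
  by rewrite (ltn_trans ltns) // ltn_expl // prime_gt1.
have Texp s y : x s * y * T s = T s * x s * y by ring.
rewrite qcoefD qcoef_delta_q qcoef_sum mulr_sumr.
under eq_bigr => i _.
  rewrite qcoef_sum (_ : _ * _ = p%:R ^+ i * (nu`_i).[x i] * x i * T i);
    last first.
    rewrite horner_coef [in RHS]mulr_sumr !mulr_suml mulr_sumr;
      apply: eq_bigr => j _.
    rewrite qcoefZ /T !qcoef_iter_qphi //; case: ifP => [pin|];
      rewrite ?mulr0 //.
    rewrite iter_delta_q iter_rmorphM iter_rmorphX iter_rmorph_int -/(x i).
    by rewrite (qexp_divn pin) -/(x i); ring.
  over.
rewrite (@eq_sum_support _ (fun i =>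
  p%:R ^+ i * (nu`_i).[x i] * x i * T i) _ n.+1);
  first last.
- by move=> i /T0 ->; rewrite mulr0.
- by move=> i lei; rewrite nth_default // horner0 mulr0 !mul0r.
rewrite qcoef_sum.
under [X in _ + X = _]eq_bigr => i _ do
  rewrite qcoefZ iter_qphi_raddf -iterSr qcoefD qcoefN mulrBr -!/(T _).
rewrite sumrB.
(* The two halves of [Phi c - c], shifted by one against each other, correspond to the factor xi_p -
   1 of mu. *)
pose a i := lam`_i * p%:R ^+ i * T i.+1; pose b i := lam`_i * p%:R ^+ i * T i.
rewrite (@eq_sum_support _ a _ n); first last.
- by move=> i lei; rewrite /a T0 ?mulr0.
- by move=> i lei; rewrite /a nth_default // !mul0r.
rewrite (@eq_sum_support _ b _ n.+1); first last.
- by move=> i lei; rewrite /b T0 ?mulr0.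
- by move=> i lei; rewrite /b nth_default // !mul0r.
have -> : \sum_(i < n) a i = \sum_(i < n.+1)
    (if i : nat is t.+1 then lam`_t * p%:R ^+ t else 0) * T i.
  by rewrite [RHS]big_ord_recl /= mul0r add0r.
rewrite -sumrB -big_split; apply: eq_bigr => i _ /=.
by rewrite mu_horner -/(x i) mulrDl mulrBl.
Qed.

Lemma unit_lam0 : nondegenerate_char p nu lam -> lam`_0 \is a GRing.unit.
Proof.
rewrite /nondegenerate_char (horner_coef0 mu) mu_horner mulr0 !add0r expr0
  mulr1.
by rewrite unitrN.
Qed.

(** Modulo p only the constant term -lambda(0) survives. This makes the denominators of the b_n
    units, and forces characteristic integers to be prime to p. *)
Lemma unit_mu0 (x : R) : nondegenerate_char p nu lam -> pdvd p 1 x ->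
  (mu`_0).[x] \is a GRing.unit.
Proof.
move=> /unit_lam0 lamU px; apply: (unit_pdvd_sub R_ur (x := - lam`_0)).
  by rewrite unitrN.
have -> : - lam`_0 - (mu`_0).[x] = - (nu`_0).[x] * x.
  by rewrite mu_horner expr0; ring.
exact: pdvdMl.
Qed.

(* The unit [lam`_0] lets one solve [log_op c = 0] for the defect
   [Phi c - c]; all other terms are visibly divisible by the exponent. *)
Lemma log_op_integrable c : nondegenerate_char p nu lam ->
  qcoef c 0 = 0 -> log_op c = 0 -> exists g, Phi c - c = delta_q g.
Proof.
move=> /unit_lam0 lamU c0 cE.
set d := Phi c - c; suff /choice[g gP] : forall n, exists y : R,
    qcoef d n = (qexp e n)%:~R * y.
  by exists (QSeries e g); apply: qseriesP => n; rewrite gP.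
elim/ltn_ind => -[_|n IHn].
  by exists 0; rewrite mulr0 qcoefD qcoefN qcoef_qphi0 c0 rmorph0 subrr.
have [Z EZ] : exists Z, log_op c =
    delta_q Z + \sum_(i < size lam) (lam`_i * p%:R ^+ i) *: iter i Phi d.
  by eexists.
have := congr1 (fun w => qcoef w n.+1) (etrans (esym EZ) cE).
have lam_gt0 : (0 < size lam)%N.
  by rewrite size_poly_gt0; apply: contraTneq lamU => ->; rewrite coef0 unitr0.
rewrite qcoefD qcoef_delta_q qcoef_sum -(prednK lam_gt0) big_ord_recl.
rewrite qcoefZ mulr1 [iter _ _ _]/=.
have [y ->] : exists y : R,
    \sum_(i < (size lam).-1) qcoef ((lam`_(lift ord0 i) * p%:R ^+ lift ord0 i)
       *: iter (lift ord0 i) Phi d) n.+1 = (qexp e n.+1)%:~R * y.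
  apply: (big_ind (fun z => exists y, z = (qexp e n.+1)%:~R * y)).
  - by exists 0; rewrite mulr0.
  - by move=> _ _ [y1 ->] [y2 ->]; exists (y1 + y2); rewrite mulrDr.
  move=> i _; rewrite qcoefZ qcoef_iter_qphi //; case: ifP => [pin|_];
    last first.
    by exists 0; rewrite !mulr0.
  (* The induction hypothesis gives divisibility by the exponent at (n + 1) / p^i; the factor p^i in
     the coefficient restores the exponent at n + 1. *)
  have [|y ->] := IHn (n.+1 %/ p ^ lift ord0 i)%N.
    by rewrite ltn_Pdiv // -{1}(expn0 p) ltn_exp2l // prime_gt1.
  exists (lam`_(lift ord0 i) * iter (lift ord0 i) phi y).
  by rewrite iter_rmorphM iter_rmorph_int (qexp_divn pin); ring.
move=> E; exists (- (lam`_0)^-1 * (qcoef Z n.+1 + y)); apply: (mulrI lamU).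
rewrite mulNr !mulrN mulrCA mulVKr //; apply/eqP.
by rewrite -addr_eq0 [X in _ + X]mulrDr addrCA; apply/eqP.
Qed.

End LogOperatorTheory.

(** * Dwork's lemma *)

Section Dwork.
Variables (p : nat) (R : idomainType) (phi : {rmorphism R -> R}) (e : bool).
Implicit Types u v w c d : {qseries e, R}.
Local Notation Phi := (@qphi p R phi e).

Hypotheses (p_prime : prime p) (R_ur : is_completed_Zp_ur p R).
Hypotheses (phi_frob : lifts_frobenius p phi).

Lemma psi_q_1DX a N : exists v : {qseries e, R},
  [/\ qcoef v 0 = 1, forall i, (i <= N)%N -> qcoef (psi_q v) i = 0
    & qcoef (psi_q v) N.+1 = (qexp e N.+1)%:~R * a].
Proof.
pose w := QSeries e (fun n => if n == N.+1 then a else 0).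
have v0 : qcoef (1 + w) 0 = 1 by rewrite qcoefD qcoef1 /= addr0.
have psiE i : (i <= N.+1)%N -> qcoef (psi_q (1 + w)) i = qcoef (delta_q w) i.
  move=> lei; have := psi_qK (qunit1 v0); rewrite delta_qD delta_q1 add0r => <-.
  move: (psi_q _) (qcoef_psi_q0 (1 + w)) => g g0;
    rewrite mulrDr mulr1 qcoefD qcoefM big1 ?addr0 // => -[[|j] /= _] _.
    by rewrite g0 mul0r.
  by rewrite ltn_eqF ?mulr0 // ltnS leq_subLR (leq_trans lei) // addSn ltnS
    leq_addl.
exists (1 + w); split=> // [i lei|].
  by rewrite psiE ?(leqW lei) // qcoef_delta_q /= ltn_eqF ?mulr0.
by rewrite psiE // qcoef_delta_q /= eqxx.
Qed.

(* Dwork's lemma.  If [u] already has the right logarithmic derivative up to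
   order [N], then the next coefficients of [psi_q u] and [c] are congruent
   modulo [N + 1], both [c] and [psi_q u] satisfying the congruence. *)
Lemma dwork_lemma c g : qcoef c 0 = 0 -> Phi c - c = delta_q g ->
  exists2 u, qcoef u 0 = 1 & psi_q u = c.
Proof.
move=> c0 cg; have neq0 := natr_neq0 p_prime R_ur.
have /choice[U UP] : forall N, exists u, qcoef u 0 = 1 /\
    forall i, (i <= N)%N -> qcoef (psi_q u) i = qcoef c i.
  elim=> [|N [u [u0 IHu]]].
    exists 1; split=> // i; rewrite leqn0 => /eqP ->.
    by rewrite qcoef_psi_q0.
  (* At order N + 1 the terms [Phi (psi_q u)] and [Phi c] agree, since they depend on orders at most
     N. Hence c - psi_q u is there the exponent times this difference. *)
  pose a := qcoef (psi_p p phi u) N.+1 - qcoef g N.+1.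
  have [v [v0 vN vN1]] := psi_q_1DX a N.
  exists (u * v); split=> [|i]; first by rewrite qcoefM0 u0 v0 mulr1.
  rewrite psi_qM ?qunit1 // qcoefD leq_eqVlt => /predU1P[->|ltiN]; last first.
    by rewrite IHu // vN // addr0.
  rewrite vN1 mulrBr -!qcoef_delta_q -cg delta_q_psi_p // !qcoefD !qcoefN
    !qcoef_qphi.
  case: ifP => [pN|_]; last by ring.
  by rewrite IHu; [ring | rewrite -ltnS ltn_Pdiv // prime_gt1].
(* The [U N] come from independent choices; they cohere because the logarithmic derivative
   determines the coefficients. *)
pose u := QSeries e (fun N => qcoef (U N) N).
have uU N i : (i <= N)%N -> qcoef u i = qcoef (U N) i.
  move=> leiN; apply: (eq_qcoef_qlog neq0 (N := i) (qcoef_psi_q0 (U i)) _ _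
    (esym (psi_qK (qunit1 (UP i).1))) (esym (psi_qK (qunit1 (UP N).1)))) => //.
    by rewrite (UP i).1 (UP N).1.
  by move=> j leji; rewrite (UP i).2 // (UP N).2 // (leq_trans leji).
have u0 : qcoef u 0 = 1 by rewrite (uU 0%N) // (UP 0%N).1.
exists u => //; apply: psi_q_eq; first exact: qunit1.
apply: qseriesP => N; rewrite qcoef_delta_q (uU N) // -qcoef_delta_q.
rewrite -(psi_qK (qunit1 (UP N).1)); apply: eq_qcoefM => i leiN.
  by rewrite (UP N).2.
by rewrite -(uU N).
Qed.

End Dwork.

(** * Exponentials over a field, and change of coefficients *)

Section QExp.
Variables (e : bool) (K : fieldType).
Hypothesis natK_neq0 : forall n, (0 < n)%N -> n%:R != 0 :> K.

Lemma delta_q_exp (f : {qseries e, K}) : qcoef f 0 = 0 ->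
  delta_q (qseries_exp f) = delta_q f * qseries_exp f.
Proof.
move=> f0; pose S M := \sum_(n < M) n`!%:R^-1 *: f ^+ n.
have SE M i : (i < M)%N -> qcoef (S M) i = qcoef (qseries_exp f) i.
  move=> ltiM; rewrite /S qcoef_sum [RHS]/=.
  transitivity (\sum_(n < M) qcoef (f ^+ n) i / n`!%:R).
    by apply: eq_bigr => n _; rewrite qcoefZ mulrC.
  apply: (@eq_sum_support _ (fun n => qcoef (f ^+ n) i / n`!%:R)) => n ltn.
    by rewrite qcoefX_small ?mul0r // (leq_trans ltiM).
  by rewrite qcoefX_small ?mul0r.
apply: qseriesP => N; rewrite qcoef_delta_q -(SE N.+2) // -qcoef_delta_q.
(* Exact for truncated exponentials; the two truncations agree with the full series up to order
   N. *)
have -> : delta_q (S N.+2) = delta_q f * S N.+1.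
  rewrite /S (raddf_sum (@delta_q K e)) big_ord_recl /= delta_qZ expr0 delta_q1
    scaler0 add0r.
  rewrite mulr_sumr; apply: eq_bigr => n _; rewrite delta_qZ delta_qX.
  rewrite -scaler_nat scalerA factS natrM invfM mulrC mulVKf ?natK_neq0 //.
  by rewrite -[f ^+ n * _]mulrC [RHS]mulrC qscaleAl (mulrC (delta_q f)).
by apply: eq_qcoefM => // i leiN; rewrite SE.
Qed.

Lemma qcoef_exp0 (f : {qseries e, K}) : qcoef (qseries_exp f) 0 = 1.
Proof. by rewrite /= big_ord1 expr0 qcoef1 divr1. Qed.

End QExp.

Section QMap.
Variables (e : bool) (R S : idomainType) (f : {rmorphism R -> S}).

Definition qmap (u : {qseries e, R}) : {qseries e, S} :=
  QSeries e (fun n => f (qcoef u n)).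

Lemma qmapM u v : qmap (u * v) = qmap u * qmap v.
Proof.
apply: qseriesP => n; rewrite /= rmorph_sum; apply: eq_bigr => i _.
by rewrite rmorphM.
Qed.

Lemma delta_q_qmap u : delta_q (qmap u) = qmap (delta_q u).
Proof. by apply: qseriesP => n /=; rewrite [in RHS]rmorphM [in RHS]rmorph_int.
  Qed.

End QMap.

(** * The basic series *)

Lemma qexp_inj e : injective (qexp e).
Proof.
by move=> i j; rewrite /qexp => /(mulfI (expf_neq0 _ _)) H; apply/eqP;
  rewrite -eqz_nat H.
Qed.

Section BasicSolutions.
Variables (p : nat) (R : idomainType) (phi : {rmorphism R -> R}) (e : bool).
Variables (nu : {poly {poly R}}) (lam : {poly R}).
Implicit Types (u v w c d : {qseries e, R}) (kappa : int).
Local Notation Phi := (@qphi p R phi e).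
Local Notation mu := (char_poly_mu p nu lam).
Local Notation log_op := (@log_op p R phi e nu lam).
Local Notation K := (K_ p nu lam e).

Hypotheses (p_prime : prime p) (R_ur : is_completed_Zp_ur p R).
Hypotheses (phi_frob : lifts_frobenius p phi).
Hypotheses (m_nondeg : nondegenerate_char p nu lam).

Let p_gt0 : (0 < p)%N := prime_gt0 p_prime.
Let neq0 := natr_neq0 p_prime R_ur.

Lemma KP kappa : kappa \in K <->
  exists2 a, (0 < a)%N & kappa = qexp e a /\ (mu`_0).[kappa%:~R] = 0.
Proof.
rewrite mem_K_ // /char_integers /char_integer /= (horner_coef0 mu); split.
  move=> [k0 k_gt0]; exists `|kappa|%N.
    by rewrite absz_gt0; apply: contraTneq k_gt0 => ->; rewrite mulr0.
  split=> //; have := gtz0_abs k_gt0; rewrite abszMsign /qexp => ->.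
  by rewrite signrMK.
move=> [a a_gt0 [-> mua]]; split=> //.
by rewrite /qexp signrMK ltz_nat.
Qed.

(** The recursion is triangular: at order n only the term s = 0 involves c_n, and its coefficient
    vanishes exactly when the exponent lies in K. *)
Lemma log_op_ker0 c : qcoef c 0 = 0 -> log_op c = 0 ->
  (forall n, qexp e n \in K -> qcoef c n = 0) -> c = 0.
Proof.
move=> c0 cE cK; apply: qseriesP; elim/ltn_ind => -[|n] IHn; first exact: c0.
have [/eqP mun|mun] := boolP ((mu`_0).[(qexp e n.+1)%:~R] == 0).
  by rewrite cK //; apply/KP; exists n.+1.
have := congr1 (fun w => qcoef w n.+1) cE; rewrite qcoef_log_op //.
rewrite big_ord_recl expn0 divn1 [iter _ _ _]/= big1 ?addr0 => [/eqP|i _].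
  by rewrite mulf_eq0 (negPf mun) => /eqP.
rewrite qcoef_iter_qphi //; case: ifP => _; rewrite ?mulr0 //.
rewrite IHn ?iter_rmorph0 ?mulr0 //.
by rewrite ltn_Pdiv // -{1}(expn0 p) ltn_exp2l // prime_gt1.
Qed.

(** This is [delta_q] of [log_basic]: the denominators kappa p^n cancel and the coefficients lie in
    R. *)
Definition log_basic_deriv kappa alpha : {qseries e, R} :=
  QSeries e (fun i => \sum_(n < i.+1 | kappa * p%:Z ^+ n == qexp e i)
    bcoef p phi nu lam kappa n * iter n phi alpha).

Lemma qexp_pX a n : qexp e a * p%:Z ^+ n = qexp e (a * p ^ n).
Proof. by rewrite qexpM -[(p ^ n)%:Z]natz natrX natz. Qed.

Lemma qcoef_log_basic_deriv a m alpha : (0 < a)%N ->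
  qcoef (log_basic_deriv (qexp e a) alpha) (a * p ^ m) =
  bcoef p phi nu lam (qexp e a) m * iter m phi alpha.
Proof.
move=> a_gt0.
have ltm : (m < (a * p ^ m).+1)%N.
  by rewrite ltnS (leq_trans (ltnW (ltn_expl m (prime_gt1 p_prime)))) //
    leq_pmull.
rewrite /= (bigD1 (Ordinal ltm)) /= ?qexp_pX // big1 ?addr0 // => n /andP[/eqP].
rewrite qexp_pX => /qexp_inj /eqP; rewrite eqn_pmul2l // eqn_exp2l ?prime_gt1
  //.
by move=> nm /negP[]; apply/eqP/val_inj/eqP.
Qed.

Lemma qcoef_log_basic_deriv0 a i alpha : (0 < a)%N ->
    (forall m, i <> (a * p ^ m)%N) ->
  qcoef (log_basic_deriv (qexp e a) alpha) i = 0.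
Proof.
move=> a_gt0 iN; rewrite /= big1 // => n /eqP; rewrite qexp_pX.
by move=> /qexp_inj /esym /iN.
Qed.

Lemma mu_rowE kappa s m : mu_row p nu lam kappa s m = (mu`_s).[(kappa * p%:Z ^+
  m)%:~R].
Proof.
rewrite horner_coef; apply: eq_bigr => j _.
by rewrite intrM exprMn rmorphXn /= -exprM mulnC mulrA.
Qed.

Lemma qcoef_log_op0 c : qcoef c 0 = 0 -> qcoef (log_op c) 0 = 0.
Proof.
move=> c0; rewrite qcoefD qcoef_delta_q0 add0r qcoef_sum big1 // => i _.
rewrite qcoefZ qcoef_iter_qphi // dvdn0 div0n qcoefD qcoefN qcoef_qphi0 c0.
by rewrite rmorph0 subrr iter_rmorph0 mulr0.
Qed.

(** For m > 0 this is the definition of b_m with its unit denominator cleared; for m = 0 it is mu(0,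
    kappa) = 0. *)
Lemma bcoef_rec kappa m : kappa \in K ->
  \sum_(s < m.+1) mu_row p nu lam kappa s (m - s) *
    iter s phi (bcoef p phi nu lam kappa (m - s)) = 0.
Proof.
move=> /KP[a a_gt0 [ka mua]]; rewrite big_ord_recl subn0 /=; case: m => [|m].
  by rewrite big_ord0 addr0 mu_rowE expr0 mulr1 mua mul0r.
rewrite bcoefS mulrC divrK; last first.
  rewrite mu_rowE; apply: (unit_mu0 R_ur) => //.
  by exists (kappa * p%:Z ^+ m)%:~R; rewrite expr1 exprS mulrCA [LHS]intrM
    -pmulrn.
by rewrite big_add1 /= big_mkord addNr.
Qed.

Lemma log_op_basic_deriv kappa alpha : kappa \in K ->
  log_op (log_basic_deriv kappa alpha) = 0.
Proof.
move=> kK; have /KP[a a_gt0 [ka _]] := kK; apply: qseriesP => -[|n].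
  apply: qcoef_log_op0; rewrite ka; apply: qcoef_log_basic_deriv0 => // m.
  by apply/nesym/eqP; rewrite -lt0n muln_gt0 a_gt0 expn_gt0 p_gt0.
rewrite qcoef_log_op //.
have T0 s : (forall m, n.+1 <> a * p ^ (m + s))%N ->
    qcoef (iter s Phi (log_basic_deriv kappa alpha)) n.+1 = 0.
  move=> nN; rewrite qcoef_iter_qphi //; case: ifP => // psn.
  rewrite ka qcoef_log_basic_deriv0 ?iter_rmorph0 // => m E.
  by apply: (nN m); rewrite expnD mulnA -E divnK.
have [[m Em]|nN] := pselect (exists m, n.+1 = (a * p ^ m)%N); last first.
  by apply: big1 => s _; rewrite T0 ?mulr0 // => m E; apply: nN;
    exists (m + s)%N.
pose F s := (mu`_s).[(qexp e (n.+1 %/ p ^ s))%:~R] *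
  qcoef (iter s Phi (log_basic_deriv kappa alpha)) n.+1.
have Fm s : (m < s)%N -> F s = 0.
  move=> ltms; rewrite /F T0 ?mulr0 // Em => m' /eqP.
  rewrite eqn_pmul2l // eqn_exp2l ?prime_gt1 // => /eqP mE.
  by rewrite mE ltnNge leq_addl in ltms.
rewrite (@eq_sum_support _ F _ m.+1) //; last first.
  move=> s lts; apply: Fm; rewrite (leq_trans _ lts) // ltnS Em.
  by rewrite (leq_trans (ltnW (ltn_expl m (prime_gt1 p_prime)))) // leq_pmull.
(* Since phi^s phi^(m-s) = phi^m, all terms share the factor phi^m(alpha). *)
transitivity ((\sum_(s < m.+1) mu_row p nu lam kappa s (m - s) *
    iter s phi (bcoef p phi nu lam kappa (m - s))) * iter m phi alpha);
      last first.
  by rewrite bcoef_rec ?mul0r.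
rewrite mulr_suml; apply: eq_bigr => -[s /=]; rewrite ltnS => lesm _.
have nE : n.+1 = (a * p ^ (m - s) * p ^ s)%N by rewrite -mulnA -expnD subnK.
rewrite /F qcoef_iter_qphi // nE dvdn_mull // mulnK ?expn_gt0 ?p_gt0 //.
rewrite ka qcoef_log_basic_deriv // iter_rmorphM -iterD subnKC //.
by rewrite mu_rowE qexp_pX mulrA.
Qed.

Lemma qcoef_log_basic_deriv_eq0 kappa alpha : kappa \in K ->
  qcoef (log_basic_deriv kappa alpha) 0 = 0.
Proof.
move=> /KP[a a_gt0 [-> _]]; apply: qcoef_log_basic_deriv0 => // m.
by apply/nesym/eqP; rewrite -lt0n muln_gt0 a_gt0 expn_gt0 p_gt0.
Qed.

(** Over Frac(R), the integral [u] given by Dwork's lemma and the exponential of [f] solve the same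
    equation with constant term 1. They coincide, so [descend] returns the coefficients of [u]. *)
Lemma basicP kappa alpha : kappa \in K ->
  qcoef (basic p phi nu lam e kappa alpha) 0 = 1 /\
  psi_q (basic p phi nu lam e kappa alpha) = log_basic_deriv kappa alpha.
Proof.
move=> kK; have /KP[a a_gt0 [ka _]] := kK.
set c := log_basic_deriv kappa alpha.
have c0 : qcoef c 0 = 0 by apply: qcoef_log_basic_deriv_eq0.
have cE : log_op c = 0 by apply: log_op_basic_deriv.
have [g cg] := log_op_integrable p_prime m_nondeg c0 cE.
have [u u0 uc] := dwork_lemma p_prime R_ur phi_frob c0 cg.
suff -> : basic p phi nu lam e kappa alpha = u by [].
have natF n : (0 < n)%N -> n%:R != 0 :> {fraction R}.
  by move=> n_gt0; rewrite -(rmorph_nat (@tofrac R)) tofrac_eq0 neq0.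
set f := log_basic p phi nu lam e kappa alpha.
have Df : delta_q f = qmap (@tofrac R) c.
  apply: qseriesP => i; rewrite qcoef_delta_q /= mulr_sumr rmorph_sum.
  apply: eq_bigr => n /eqP <-; rewrite mulrC divfK //.
  rewrite ka qexp_pX; apply: (qexp_neq0 _ natF).
  by rewrite muln_gt0 a_gt0 expn_gt0 p_gt0.
have f0 : qcoef f 0 = 0.
  rewrite /= big_pred0 // => n; rewrite ka qexp_pX.
  apply/negP => /eqP/qexp_inj/eqP.
  by rewrite muln_eq0 expn_eq0 -!leqn0 leqNgt a_gt0 leqNgt p_gt0.
have expf : qseries_exp f = qmap (@tofrac R) u.
  apply: (qlog_eq_inj natF (c := delta_q f)).
  - exact: qcoef_delta_q0.
  - by rewrite qcoef_exp0 /= u0 rmorph1.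
  - exact: delta_q_exp.
  - by rewrite delta_q_qmap Df -qmapM -uc psi_qK // qunit1.
apply: qseriesP => i; change (descend (qcoef (qseries_exp f) i) = qcoef u i).
by rewrite expf descend_tofrac.
Qed.

End BasicSolutions.

(** * Roots of unity *)

(* The powers of [y] take finitely many values, as they only depend on the
   residues of the powers of 'X modulo [f] over 'F_p. *)
Lemma Fp_algebraic_unity_root (p : nat) (k : fieldType) (iota : {rmorphism 'F_p
  -> k})
    (f : {poly int}) (y : k) :
    map_poly intr f != 0 :> {poly k} -> root (map_poly intr f) y -> y != 0 ->
  exists2 n, (0 < n)%N & y ^+ n = 1.
Proof.
move=> f_neq0 fy y_neq0.
pose h : {poly 'F_p} := map_poly intr f.
have hE : map_poly iota h = map_poly intr f.
  by rewrite -map_poly_comp; apply: eq_map_poly => c; rewrite /= rmorph_int.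
have h_neq0 : h != 0 by rewrite -(map_poly_eq0 iota) hE.
pose d := (size h).-1; pose rem i : {poly 'F_p} := 'X^i %% h.
have sz i : (size (rem i) <= d)%N.
  by rewrite -ltnS /d prednK ?size_poly_gt0 // ltn_modp.
have yE i : y ^+ i = (map_poly iota (rem i)).[y].
  have := congr1 (fun q => (map_poly iota q).[y]) (divp_eq 'X^i h).
  rewrite map_polyXn hornerXn => ->; rewrite rmorphD rmorphM /= hornerD hornerM
    hE.
  by rewrite (rootP fy) mulr0 add0r.
pose r (i : 'I_#|'rV['F_p]_d|.+1) : 'rV['F_p]_d := poly_rV (rem i).
have /injectivePn[i [j ij rij]] : ~~ injectiveb r.
  by apply/negP => /injectiveP /leq_card; rewrite card_ord ltnn.
have {rij} yij : y ^+ i = y ^+ j.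
  by rewrite !yE -(poly_rV_K (sz i)) -(poly_rV_K (sz j)) -/(r i) -/(r j) rij.
wlog ltij : i j ij yij / (i < j)%N => [th|].
  case: (ltngtP i j) => [||/val_inj E]; last by rewrite E eqxx in ij.
    exact: th.
  by apply: th; rewrite // eq_sym.
exists (j - i)%N; first by rewrite subn_gt0.
apply: (mulfI (expf_neq0 i y_neq0)).
by rewrite -exprD subnKC ?(ltnW ltij) // mulr1.
Qed.

Lemma algebraic_unity_root (k : fieldType) (p : nat) (f : {poly int}) (y : k) :
    p \in [pchar k] -> map_poly intr f != 0 :> {poly k} ->
    root (map_poly intr f) y -> y != 0 ->
  exists2 n, (0 < n)%N & y ^+ n = 1.
Proof.
move=> kp; have p_prime := pcharf_prime kp.
exact: (@Fp_algebraic_unity_root p (pPrimeCharType kp) (in_alg (pPrimeCharType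
  kp)) f y).
Qed.

(** In characteristic p, 1 is the only root of unity of p-power order. *)
Lemma unity_root_coprime (k : fieldType) (p : nat) (y : k) n :
    p \in [pchar k] -> (0 < n)%N -> y ^+ n = 1 ->
  exists m, [/\ (0 < m)%N, coprime p m & y ^+ m = 1].
Proof.
move=> kp n_gt0 yn; have p_prime := pcharf_prime kp.
have unity_p w v : w ^+ (p ^ v) = 1 :> k -> w = 1.
  elim: v => [|v IHv]; first by rewrite expr1.
  rewrite expnSr exprM => wv; apply: IHv; apply/eqP; rewrite -subr_eq0.
  suff : (w ^+ (p ^ v) - 1) ^+ p == 0 by rewrite expf_eq0 => /andP[].
  by rewrite -(pFrobenius_autE kp) rmorphB rmorph1 /= pFrobenius_autE wv subrr.
exists (n`_p^')%N; split; first by rewrite part_gt0.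
  by rewrite prime_coprime // -p'natE // part_pnat.
apply: (unity_p _ (logn p n)); rewrite -exprM mulnC.
by rewrite -p_part partnC.
Qed.

Section UnityRoots.
Variables (p : nat) (R : idomainType) (phi : {rmorphism R -> R}).
Hypotheses (p_prime : prime p) (R_ur : is_completed_Zp_ur p R).

Let p_gt0 : (0 < p)%N := prime_gt0 p_prime.

(** Each p-th power gains a factor p: if a = b modulo p, the cofactor of a - b in a^p - b^p is p
    b^(p-1) = 0 modulo p. *)
Lemma pdvd_subXp j (x y : R) : pdvd p 1 (x - y) ->
  pdvd p j.+1 (x ^+ (p ^ j) - y ^+ (p ^ j)).
Proof.
move=> xy; elim: j => [|j IHj]; first by rewrite expn0.
rewrite expnSr !exprM; set a := x ^+ _ in IHj *; set b := y ^+ _ in IHj *.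
rewrite subrXX -addn1; apply: pdvdM => //.
have ab : pdvd p 1 (a - b) by apply: pdvd_leq IHj.
have -> : \sum_(i < p) a ^+ (p.-1 - i) * b ^+ i =
    \sum_(i < p) (a ^+ (p.-1 - i) - b ^+ (p.-1 - i)) * b ^+ i + b ^+ p.-1 *+ p.
  rewrite -[X in _ *+ X](card_ord p) -sumr_const -big_split /=.
  apply: eq_bigr => i _; rewrite mulrBl -exprD subnK ?subrK //.
  by rewrite -ltnS prednK.
apply: pdvdD; first by apply: pdvd_sum => i _; apply/pdvdMr/pdvd_subX.
by rewrite -mulr_natr; apply/pdvdMl/pdvd_nat.
Qed.

Lemma teichmuller (k : fieldType) (red : {rmorphism R -> k}) (y : k) n :
    (forall x, red x = 0 <-> pdvd p 1 x) -> (forall z, exists x, red x = z) ->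
    (0 < n)%N -> y ^+ n = 1 ->
  exists z, red z = y /\ exists2 m, (0 < m)%N & z ^+ m = 1.
Proof.
move=> redP red_surj n_gt0 yn.
have redB (a b : R) : red a = red b -> pdvd p 1 (a - b).
  by move=> ab; apply/redP; rewrite rmorphB ab subrr.
have kp : p \in [pchar k].
  by rewrite inE p_prime -(rmorph_nat red); apply/eqP/redP/pdvd_nat.
have [m [m_gt0 pm ym]] := unity_root_coprime kp n_gt0 yn.
(* By Euler p^f = 1 modulo m, so [y] is fixed by the p^f-th power; the lift sought is the limit of
   the x^(p^(f i)) for any lift x of [y]. *)
set f := totient m; have f_gt0 : (0 < f)%N by rewrite totient_gt0.
have yq : y ^+ (p ^ f) = y.
  by rewrite -(expr_mod _ ym) Euler_exp_totient // (expr_mod _ ym) expr1.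
have [x redx] := red_surj y.
pose s i := x ^+ (p ^ (f * i)).
have le_f i : (i <= f * i)%N by rewrite leq_pmull.
have [i|l _ sl] := pdvd_limit R_ur (s := s).
  rewrite /s mulnS expnD exprM; apply: (pdvd_leq (leqW (le_f i))).
  by apply/pdvd_subXp/redB; rewrite rmorphXn redx.
exists l; split.
  have /redP := sl 1%N 1%N (leqnn _);
    rewrite rmorphB /s muln1 rmorphXn /= redx yq.
  by move/eqP; rewrite subr_eq0 => /eqP.
exists m => //; apply/eqP; rewrite -subr_eq0;
  apply/eqP/(Zp_ur_separated R_ur) => i.
rewrite -(subrKA (s i ^+ m)); apply: pdvdD.
  by rewrite -opprB; apply/pdvdN/pdvd_subX/sl.
rewrite /s -exprM mulnC exprM -(expr1n _ (p ^ (f * i))).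
apply: (pdvd_leq (leqW (le_f i))); apply/pdvd_subXp/redB.
by rewrite rmorphXn redx ym rmorph1.
Qed.

(** If b is nonzero modulo p, its class has a kappa-th root in the closed field k. This is a root of
    unity, as k is algebraic over F_p, and it lifts to R. The digit [t] = 0 covers the class 0. *)
Lemma unity_root_digit (kappa : int) (b : R) : kappa != 0 ->
  exists t z, (exists2 m, (0 < m)%N & z ^+ m = 1) /\
    pdvd p 1 (b - (t : bool)%:R * z ^ kappa).
Proof.
have [k [red [red_surj redP k_alg]]] := Zp_ur_residue R_ur.
have kp : p \in [pchar k].
  by rewrite inE p_prime -(rmorph_nat red); apply/eqP/redP/pdvd_nat.
move=> kappa_neq0; have [/redP b0|b_neq0] := eqVneq (red b) 0.
  by exists false, 1; split; [exists 1%N | rewrite mul0r subr0].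
have [w w_neq0 wk] : exists2 w : k, w != 0 & w ^ kappa = red b.
  have root_nat a (c : k) : (0 < a)%N -> c != 0 -> exists2 w,
    w != 0 & w ^+ a = c.
    move=> a_gt0 c_neq0; have /closed_rootP[w] : size ('X^a - c%:P) != 1%N.
      by rewrite size_XnsubC // eqSS -lt0n.
    rewrite rootE !hornerE subr_eq0 => /eqP wa; exists w => //.
    by apply: contraNneq c_neq0 => w0; rewrite -wa w0 expr0n gtn_eqF.
  case: kappa kappa_neq0 => a a_neq0.
    by have [|w ? ?] := root_nat a _ _ b_neq0; [rewrite lt0n | exists w].
  have [|w w_neq0 wa] := root_nat a.+1 (red b)^-1 (ltn0Sn a);
    first by rewrite invr_eq0.
  by exists w; rewrite // NegzE -exprnN wa invrK.
have [f f_neq0 fw] := k_alg w.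
have [n n_gt0 wn] := algebraic_unity_root kp f_neq0 fw w_neq0.
have [z [redz [m m_gt0 zm]]] := teichmuller redP red_surj n_gt0 wn.
exists true, z; split; first by exists m.
apply/redP; rewrite mul1r rmorphB rmorphXz /=.
  by rewrite redz wk subrr.
by apply/unitrPr; exists (z ^+ m.-1); rewrite -exprS prednK.
Qed.

Hypothesis p_neq2 : p != 2%N.

(** If x is not 1, then 1 + x + ... + x^(l-1) = 0. For l different from p this sum is l modulo p, a
    unit. For l = p and x = 1 + p y it is p + p y C(p, 2) modulo p^2, and p divides C(p, 2) as p is
    odd. For p = 2, x = -1 is a counterexample. *)
Lemma prime_unity_root_cong1 (l : nat) (x : R) : prime l -> x ^+ l = 1 ->
  pdvd p 1 (x - 1) -> x = 1.
Proof.
move=> l_prime xl px; apply/eqP; rewrite -subr_eq0; apply/negPn/negP => x_neq1.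
have /eqP := subrX1 x l; rewrite xl subrr eq_sym mulf_eq0 (negPf x_neq1) /= =>
  /eqP.
have [Elp|l_neqp] := eqVneq l p; last first.
  move=> S0; have lU : l%:R \is a @GRing.unit R.
    apply: (natr_unit p_prime R_ur); rewrite dvdn_prime2 //.
    by rewrite eq_sym.
  apply: (pdvd_nunit R_ur lU).
  rewrite -[l%:R]subr0 -S0 -[l in X in X - _](card_ord l) -sumr_const -sumrB.
  apply: pdvd_sum => i _; rewrite -[X in X - _](expr1n _ i) -opprB.
  exact/pdvdN/pdvd_subX.
rewrite Elp => S0; have [y Ey] := px; rewrite expr1 in Ey.
have xi i : pdvd p 2 (x ^+ i - 1 - (p%:R * y) *+ i).
  elim: i => [|i IHi]; first by rewrite expr0 subrr mulr0n subr0; apply: pdvd0.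
  have -> : x ^+ i.+1 - 1 - p%:R * y *+ i.+1 =
      x * (x ^+ i - 1 - p%:R * y *+ i) + p%:R ^+ 2 * (y ^+ 2 *+ i).
    have -> : p%:R ^+ 2 * (y ^+ 2 *+ i) = p%:R * y * (p%:R * y *+ i).
      by rewrite !mulrnAr -exprMn expr2.
    by rewrite exprS mulrS -Ey; move: (_ *+ i) => z; ring.
  by apply: pdvdD; [apply: pdvdMl | apply/pdvdMr/pdvd_pX].
suff : pdvd p 1 (1 : R) by apply: (pdvd_nunit R_ur); apply: unitr1.
apply: (pdvd_cancel p_prime R_ur (j := 1)); rewrite expr1 mulr1.
have -> : p%:R = - (\sum_(i < p) (x ^+ i - 1 - (p%:R * y) *+ i)) - (p%:R * y)
  *+ 'C(p, 2).
  rewrite !sumrB S0 sumr_const card_ord sumrMnr -bin2_sum big_mkord.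
  by rewrite sub0r opprD !opprK addrK.
apply: pdvdB; first by apply/pdvdN/pdvd_sum => i _; apply: xi.
rewrite -mulr_natr -mulrA; apply: (pdvdM (j := 1) (k := 1)).
  by exists 1; rewrite mulr1.
apply/pdvdMl/pdvd_nat/prime_dvd_bin => //=.
by rewrite ltn_neqAle eq_sym p_neq2 prime_gt1.
Qed.

Lemma unity_root_cong1 n (x : R) : (0 < n)%N -> x ^+ n = 1 ->
  pdvd p 1 (x - 1) -> x = 1.
Proof.
elim/ltn_ind: n => n IHn n_gt0 xn px.
have [n1|n_neq1] := eqVneq n 1%N; first by rewrite n1 in xn.
have l_prime : prime (pdiv n) by rewrite pdiv_prime // ltn_neqAle eq_sym n_neq1.
have nE : n = ((n %/ pdiv n) * pdiv n)%N by rewrite divnK // pdiv_dvd.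
apply: (IHn (n %/ pdiv n)%N) => //.
- by rewrite ltn_Pdiv // prime_gt1.
- by rewrite divn_gt0 ?pdiv_gt0 // pdiv_leq.
apply: (prime_unity_root_cong1 l_prime); first by rewrite -exprM -nE.
by rewrite -(expr1n _ (n %/ pdiv n)); apply: pdvd_subX.
Qed.

Hypothesis phi_frob : lifts_frobenius p phi.

(** The quotient phi(z) / z^p is a root of unity congruent to 1 modulo p. *)
Lemma phi_unity_root n (z : R) : (0 < n)%N -> z ^+ n = 1 -> phi z = z ^+ p.
Proof.
move=> n_gt0 zn; have zU : z \is a GRing.unit.
  by apply/unitrPr; exists (z ^+ n.-1); rewrite -exprS prednK.
have zpU : z ^+ p \is a GRing.unit by rewrite unitrX.
apply: (divIr zpU); rewrite divrr //; apply: (unity_root_cong1 n_gt0).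
  by rewrite exprMn exprVn -rmorphXn -exprM mulnC exprM zn expr1n rmorph1 divr1.
by rewrite -(divrr zpU) -mulrBl; apply/pdvdMr/phi_frob.
Qed.

End UnityRoots.

(** * Convolution *)

Section GroupRingAction.
Variables (p : nat) (R : idomainType) (phi : {rmorphism R -> R}) (e : bool).
Implicit Types (u v w c : {qseries e, R}) (kappa : int).
Hypotheses (p_prime : prime p) (R_ur : is_completed_Zp_ur p R).

Local Notation neq0 := (natr_neq0 p_prime R_ur).

Lemma unity_root_unit n (z : R) : (0 < n)%N -> z ^+ n = 1 -> z \is a GRing.unit.
Proof.
by move=> n_gt0 zn; apply/unitrPr; exists (z ^+ n.-1); rewrite -exprS prednK.
Qed.

Lemma Zmu_supp_unit (f : Zmu R) z : z \in finsupp f -> z \is a GRing.unit.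
Proof. by move=> /Zmu_supp[n n_gt0 /unity_root_unit]; apply. Qed.

Lemma Zmu_eval_fset kappa (f : Zmu R) (S : {fset R}) : (finsupp f `<=` S)%fset
  ->
  Zmu_eval kappa f = \sum_(z <- S) (f z)%:~R * z ^ kappa.
Proof.
move=> fS; apply: big_fset_incl => // z _ zNf.
by rewrite fsfun_dflt // mul0r.
Qed.

Lemma Zmu_hat_eval_lim kappa (f : Zmu_hat p R) k n : (k <= n)%N ->
  pdvd p k (Zmu_eval kappa (f n) - Zmu_hat_eval kappa f).
Proof.
rewrite /Zmu_hat_eval; have [m|l -> fl] := pdvd_limit R_ur (s := fun n =>
  Zmu_eval kappa (f n)).
  pose S := (finsupp (f m) `|` finsupp (f m.+1))%fset.
  rewrite (@Zmu_eval_fset _ (f m) S) ?fsubsetUl //.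
  rewrite (@Zmu_eval_fset _ (f m.+1) S) ?fsubsetUr // -sumrB.
  apply: pdvd_sum => z _; rewrite -mulrBl -rmorphB /=; apply: pdvdMr.
  have /dvdzP[a ->] := Zmu_coherent f m z.
  by exists a%:~R; rewrite rmorphM rmorphXn mulrC.
exact: fl.
Qed.

Lemma qcoef_qdilate z u n : qcoef (qdilate z u) n = z ^ qexp e n * qcoef u n.
Proof. by []. Qed.

Lemma qdilateM z u v : z \is a GRing.unit ->
  qdilate z (u * v) = qdilate z u * qdilate z v.
Proof.
move=> zU; apply: qseriesP => n; rewrite qcoef_qdilate !qcoefM mulr_sumr.
apply: eq_bigr => -[i /=]; rewrite ltnS => lein _.
by rewrite -{1}(subnKC lein) qexpD exprzDr //; ring.
Qed.

Lemma delta_q_qdilate z u : delta_q (qdilate z u) = qdilate z (delta_q u).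
Proof. by apply: qseriesP => n /=; rewrite mulrCA. Qed.

Lemma qcoef_qdilate0 z u : qcoef (qdilate z u) 0 = qcoef u 0.
Proof. by rewrite /= qexp0 expr0z mul1r. Qed.

Lemma psi_q_qdilate z u : z \is a GRing.unit -> u \is a GRing.unit ->
  psi_q (qdilate z u) = qdilate z (psi_q u).
Proof.
move=> zU uU; apply: psi_q_eq; first by rewrite qunitE qcoef_qdilate0.
by rewrite delta_q_qdilate -qdilateM // psi_qK.
Qed.

Lemma qcoefXz0 u (k : int) : qcoef u 0 = 1 -> qcoef (u ^ k) 0 = 1.
Proof.
move=> u0; have uX n : qcoef (u ^+ n) 0 = 1 by rewrite qcoefX0 u0 expr1n.
by case: k => n; [apply: uX | rewrite NegzE -exprnN; apply: qcoef0V].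
Qed.

Lemma qcoef_prod0 (I : Type) (r : seq I) (P : pred I) (F : I -> {qseries e,
  R}) :
  (forall i, P i -> qcoef (F i) 0 = 1) ->
    qcoef (\prod_(i <- r | P i) F i) 0 = 1.
Proof.
move=> F0; apply: (big_ind (fun u => qcoef u 0 = 1)) => //.
by move=> u v u0 v0; rewrite qcoefM0 u0 v0 mulr1.
Qed.

Lemma qcoef_mulrz u (k : int) n : qcoef (u *~ k) n = qcoef u n *~ k.
Proof.
by case: k => m; rewrite ?NegzE ?mulrNz ?qcoefN -?pmulrn qcoef_mulrn.
Qed.

Lemma Zmu_actP (f : Zmu R) u : qcoef u 0 = 1 ->
  qcoef (Zmu_act f u) 0 = 1 /\
  forall n, qcoef (psi_q (Zmu_act f u)) n =
    Zmu_eval (qexp e n) f * qcoef (psi_q u) n.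
Proof.
move=> u0; split=> [|n].
  by apply: qcoef_prod0 => z _; apply: qcoefXz0; rewrite qcoef_qdilate0.
have dU z : qdilate z u \is a GRing.unit by apply: qunit1;
  rewrite qcoef_qdilate0.
rewrite psi_q_prod => [|z _]; last by apply: qunit1; apply: qcoefXz0;
  rewrite qcoef_qdilate0.
rewrite qcoef_sum mulr_suml !big_seq; apply: eq_bigr => z /Zmu_supp_unit zU.
rewrite psi_qXz // qcoef_mulrz psi_q_qdilate ?qunit1 // qcoef_qdilate.
by rewrite -mulrzl mulrA.
Qed.

(* Every [b] is [sum_i p^i t_i z_i^kappa] with [t_i] in {0, 1} and [z_i] roots
   of unity. *)
Lemma Zmu_hat_eval_surj kappa (b : R) : kappa != 0 ->
  exists f : Zmu_hat p R, Zmu_hat_eval kappa f = b.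
Proof.
move=> kappa_neq0.
have /choice[t /choice[z /all_and2 [zP tzP]]] :=
  fun b => unity_root_digit p_prime R_ur b kappa_neq0.
have /choice[q qP] : forall b, exists b',
  b = (t b : bool)%:R * z b ^ kappa + p%:R * b'.
  by move=> c; have [y] := tzP c; rewrite expr1 => E; exists y;
    rewrite -E addrC subrK.
pose d i := iter i q b.
have dP n : b =
    \sum_(i < n) p%:R ^+ i * (t (d i))%:R * z (d i) ^ kappa + p%:R ^+ n * d n.
  elim: n => [|n IHn]; first by rewrite big_ord0 add0r mul1r.
  rewrite {1}IHn big_ord_recr /= -addrA; congr (_ + _).
  by rewrite [in LHS](qP (d n)) mulrDr !mulrA exprSr.
pose S n := [fset z (d i) | i in iota 0 n]%fset.
(* Different digits may use the same root of unity, so the coefficient at [x] collects all of them.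
   Passing from n to n + 1 adds at most one term p^n, whence coherence. *)
pose F n (x : R) : int :=
  \sum_(i < n | z (d i) == x) p%:Z ^+ i * (t (d i) : nat)%:Z.
pose G n : {fsfun R -> int with 0} := [fsfun x in S n => F n x].
have GE n x : G n x = F n x.
  rewrite fsfunE; case: ifP => // /negP xS; rewrite /F big_pred0 // => i.
  apply/eqP => zx; case: xS; rewrite -zx; apply/imfsetP;
    exists (i : nat) => //=.
  by rewrite mem_iota add0n ltn_ord.
have GS n : (finsupp (G n) `<=` S n)%fset.
  apply/fsubsetP => x; rewrite mem_finsupp; apply: contraR => xS.
  by rewrite fsfunE (negPf xS).
have G_supp n x : x \in finsupp (G n) -> exists2 m, (0 < m)%N & x ^+ m = 1.
  by move=> /(fsubsetP (GS n))/imfsetP[i _ ->]; apply: zP.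
pose f n := Build_Zmu (@G_supp n).
have f_coh n x : (p%:Z ^+ n %| f n.+1 x - f n x)%Z.
  rewrite /= !GE /F big_mkcond big_ord_recr /= -big_mkcond addrC addrK.
  by case: ifP => _; rewrite ?dvdz0 // dvdz_mulr.
exists (Build_Zmu_hat f_coh); apply: (plim_eq R_ur) => k; exists k => n lekn.
apply: (pdvd_leq lekn); rewrite -opprB; apply: pdvdN.
rewrite {1}(dP n) (Zmu_eval_fset kappa (f := f n) (GS n)).
have -> : \sum_(x <- S n) (f n x)%:~R * x ^ kappa =
    \sum_(i < n) p%:R ^+ i * (t (d i))%:R * z (d i) ^ kappa.
  rewrite (eq_bigr (fun x => \sum_(i < n | z (d i) == x)
      p%:R ^+ i * (t (d i))%:R * z (d i) ^ kappa)); last first.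
    move=> x _; rewrite [f n x]GE rmorph_sum mulr_suml;
      apply: eq_bigr => i /eqP ->.
    by rewrite rmorphM rmorphXn /= -!pmulrn.
  rewrite (exchange_big_dep xpredT) //=; apply: eq_bigr => i _.
  rewrite (eq_bigl (pred1 (z (d i)))); last by move=> x; rewrite /= eq_sym.
  rewrite -big_filter filter_pred1_uniq ?fset_uniq ?big_seq1 //.
  by apply/imfsetP; exists (i : nat); rewrite //= mem_iota add0n ltn_ord.
by rewrite addrC addKr; apply/pdvdMr/pdvd_pX.
Qed.

Hypotheses (phi_frob : lifts_frobenius p phi) (p_neq2 : p != 2%N).

Lemma iter_phi_Zmu_eval m kappa (f : Zmu R) :
  iter m phi (Zmu_eval kappa f) = Zmu_eval (kappa * p%:Z ^+ m) f.
Proof.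
elim: m => [|m IHm]; first by rewrite expr0 mulr1.
rewrite iterS IHm /Zmu_eval rmorph_sum !big_seq; apply: eq_bigr => z zf.
have zU := Zmu_supp_unit zf; have [n n_gt0 zn] := Zmu_supp zf.
rewrite rmorphM rmorph_int rmorphXz //= (phi_unity_root p_prime R_ur p_neq2
  phi_frob n_gt0 zn).
by rewrite (exprz_exp z p) exprS mulrCA.
Qed.

Lemma pdvd_psi_q j N v : qcoef v 0 = 1 ->
  (forall i, pdvd p (N + j) (qcoef (psi_q v) i)) -> (0 < N)%N ->
    pdvd p j (qcoef v N).
Proof.
move=> v0 vj N_gt0; apply: (pdvd_cancel_nat p_prime R_ur N_gt0).
have /(congr1 (fun w : {qseries e, R} => qcoef w N)) := psi_qK (qunit1 v0).
rewrite qcoefM qcoef_delta_q => E.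
have -> : N%:R * qcoef v N = (-1) ^+ e * ((qexp e N)%:~R * qcoef v N).
  by rewrite /qexp intrM intr_sign -mulrA signrMK.
by rewrite -E; apply/pdvdMl/pdvd_sum => i _; apply/pdvdMr.
Qed.

End GroupRingAction.

(** * The module of solutions *)

Section Solutions.
Variables (p : nat) (R : idomainType) (phi : {rmorphism R -> R}) (e : bool).
Variables (nu : {poly {poly R}}) (lam : {poly R}).
Implicit Types (u v w c : {qseries e, R}) (kappa : int) (a : int -> R).
Hypotheses (p_prime : prime p) (p_neq2 : p != 2%N).
Hypotheses (R_ur : is_completed_Zp_ur p R) (phi_frob : lifts_frobenius p phi).
Hypotheses (m_nondeg : nondegenerate_char p nu lam).

Local Notation log_op := (@log_op p R phi e nu lam).
Local Notation K := (K_ p nu lam e).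
Local Notation U := (U_ p phi nu lam e).
Local Notation basic := (basic p phi nu lam e).
Local Notation log_basic_deriv := (@log_basic_deriv p R phi e nu lam).
Local Notation star := (star p phi nu lam).

(* Otherwise unification starts computing coefficients of the exponential. *)
Local Opaque Defs.basic.

Let neq0 := natr_neq0 p_prime R_ur.
Let KP := KP e p_prime R_ur m_nondeg.
Let basicP kappa alpha := @basicP p R phi e nu lam p_prime R_ur phi_frob
  m_nondeg kappa alpha.

Lemma log_basic_derivB kappa alpha beta :
  log_basic_deriv kappa (alpha - beta) =
  log_basic_deriv kappa alpha - log_basic_deriv kappa beta.
Proof.
apply: qseriesP => n; rewrite qcoefD qcoefN /= -sumrB; apply: eq_bigr => i _.
by rewrite iter_rmorphB mulrBr.
Qed.

Lemma basicM kappa alpha beta : kappa \in K ->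
  basic kappa alpha = basic kappa beta * basic kappa (alpha - beta).
Proof.
move=> kK; have := log_basic_derivB kappa alpha beta.
case: (basicP alpha kK) (basicP beta kK) (basicP (alpha - beta) kK) =>
  + + [+ +] [+ +].
move: (basic _ alpha) (basic _ beta) (basic _ (alpha - beta)) => u v w.
move=> u0 <- v0 <- w0 <- uvw; apply: (psi_q_inj neq0 u0).
  by rewrite qcoefM0 v0 w0 mulr1.
by rewrite psi_qM ?qunit1 // uvw addrC subrK.
Qed.

(** The quotient of the two series is the basic series of alpha - beta. Its logarithmic derivative
    is divisible by p^(N+j), so up to order N it is 1 modulo p^j. *)
Lemma basic_continuous kappa alpha beta j N : kappa \in K ->
  pdvd p (N + j) (alpha - beta) ->
  pdvd p j (qcoef (basic kappa alpha) N - qcoef (basic kappa beta) N).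
Proof.
move=> kK pab; rewrite (basicM alpha beta kK).
case: (basicP (alpha - beta) kK); move: (basic _ beta) (basic _ (alpha - beta))
  => u v v0 vE.
have -> : qcoef (u * v) N - qcoef u N = qcoef (u * (v - 1)) N.
  by rewrite mulrBr mulr1 qcoefD qcoefN.
rewrite qcoefM; apply: pdvd_sum => i _; apply: pdvdMl.
have: (N - i <= N)%N by rewrite leq_subr.
case: (N - i)%N => [|n] len; first by rewrite qcoefD qcoefN qcoef1 v0 subrr;
  apply: pdvd0.
rewrite qcoefD qcoefN qcoef1 subr0; apply: (pdvd_psi_q p_prime R_ur v0) => // m.
rewrite vE; apply: pdvd_sum => k _; apply: pdvdMl.
have /(pdvd_leq (leq_add len (leqnn j)))[y ->] := pab.
exists (iter k phi y); rewrite iter_rmorphM iter_rmorphX; congr (_ ^+ _ * _).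
by have := iter_rmorph_int phi k p%:Z.
Qed.

(** At exponent kappa p^m, f multiplies the logarithmic derivative by f(kappa p^m) =
    phi^m(f(kappa)), which is the effect of multiplying alpha by f(kappa). *)
Lemma Zmu_act_basic kappa alpha (f : Zmu R) : kappa \in K ->
  Zmu_act f (basic kappa alpha) = basic kappa (Zmu_eval kappa f * alpha).
Proof.
move=> kK; case: (basicP alpha kK) (basicP (Zmu_eval kappa f * alpha) kK) =>
  + + [].
move: (basic _ alpha) (basic _ (_ * alpha)) => u v u0 uE v0 vE.
have [f0 fE] := Zmu_actP f u0.
apply: (psi_q_inj neq0 f0 v0); apply: qseriesP => n; rewrite fE uE vE.
rewrite mulr_sumr; apply: eq_bigr => m /eqP <-.
by rewrite iter_rmorphM (iter_phi_Zmu_eval p_prime R_ur phi_frob p_neq2) mulrCA.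
Qed.

Lemma Zmu_hat_act_basic kappa alpha (f : Zmu_hat p R) : kappa \in K ->
  Zmu_hat_act f (basic kappa alpha) = basic kappa (Zmu_hat_eval kappa f *
    alpha).
Proof.
move=> kK; apply: qseriesP => N; apply: (plim_eq R_ur) => k;
  exists (N + k)%N => n len.
rewrite Zmu_act_basic //; apply: basic_continuous => //; rewrite -mulrBl.
exact/pdvdMr/Zmu_hat_eval_lim.
Qed.

Lemma star_kappa_basic kappa alpha beta : kappa \in K ->
  star_kappa p kappa beta (basic kappa alpha) = basic kappa (beta * alpha).
Proof.
move=> kK; have kappa_neq0 : kappa != 0.
  have /KP[n n_gt0 [-> _]] := kK.
  by apply: contraTneq n_gt0; rewrite -(qexp0 e) => /qexp_inj ->.
have [f fE] := Zmu_hat_eval_surj p_prime R_ur beta kappa_neq0.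
apply: xget_unique => /= [|_ [g gE ->]].
  by exists f => //; rewrite (Zmu_hat_act_basic _ _ kK) fE.
by rewrite (Zmu_hat_act_basic _ _ kK) gE.
Qed.

Lemma B0_qexp u n : B0 u (qexp e n) = qcoef (psi_q u) n.
Proof. by rewrite /B0 /qexp abszMsign /= eqxx. Qed.

Lemma B0M u v kappa : u \is a GRing.unit -> v \is a GRing.unit ->
  B0 (u * v) kappa = B0 u kappa + B0 v kappa.
Proof. by move=> uU vU; rewrite /B0 psi_qM // qcoefD; case: ifP;
  rewrite ?addr0. Qed.

Lemma UE u : U u <-> qcoef u 0 = 1 /\ log_op (psi_q u) = 0.
Proof.
split=> -[u0 uE]; split=> //.
  by rewrite -(delta_q_psi nu lam p_prime R_ur phi_frob u0) uE raddf0.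
apply: qseriesP => -[|n].
  exact: (qcoef_psi0 nu lam p_prime R_ur phi_frob u0).
apply: (mulfI (qexp_neq0 e neq0 (ltn0Sn n))); rewrite mulr0 -qcoef_delta_q.
by rewrite (delta_q_psi nu lam p_prime R_ur phi_frob u0) uE.
Qed.

Lemma U_unit u : U u -> u \is a GRing.unit.
Proof. by case=> /qunit1. Qed.

Lemma U1 : U 1.
Proof. by apply/UE; rewrite psi_q1 raddf0. Qed.

Lemma UM u v : U u -> U v -> U (u * v).
Proof.
move=> uU vU; have [/UE[u0 uE] /UE[v0 vE]] := (uU, vU); apply/UE.
by rewrite qcoefM0 u0 v0 mulr1 psi_qM ?U_unit // raddfD /= uE vE addr0.
Qed.

Lemma UV u : U u -> U u^-1.
Proof.
move=> uU; have /UE[u0 uE] := uU; apply/UE.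
by rewrite qcoef0V // psi_qV ?U_unit // raddfN /= uE oppr0.
Qed.

Lemma U_basic kappa alpha : kappa \in K -> U (basic kappa alpha).
Proof.
move=> kK; have [b0 bE] := basicP alpha kK; apply/UE; rewrite bE.
by split=> //; apply: log_op_basic_deriv.
Qed.

Lemma B0_U_inj u v : U u -> U v -> {in K, B0 u =1 B0 v} -> u = v.
Proof.
move=> /UE[u0 uE] /UE[v0 vE] uv; apply: (psi_q_inj neq0 u0 v0).
apply/eqP; rewrite -subr_eq0; apply/eqP.
apply: (log_op_ker0 (phi := phi) p_prime R_ur m_nondeg).
- by rewrite qcoefD qcoefN !qcoef_psi_q0 subrr.
- by rewrite raddfB /= uE vE subrr.
by move=> n nK; rewrite qcoefD qcoefN -!B0_qexp uv ?subrr.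
Qed.

Lemma K_prime_to_p n : qexp e n \in K -> ~~ (p %| n)%N.
Proof.
move=> /KP[m m_gt0 [/qexp_inj -> mu0]]; apply/negP => /dvdnP[l El].
have : ((char_poly_mu p nu lam)`_0).[(qexp e m)%:~R] \is a GRing.unit.
  apply: (unit_mu0 R_ur) => //; rewrite El qexpM intrM; apply: pdvdMl.
  by rewrite -pmulrn; apply: pdvd_nat.
by rewrite mu0 unitr0.
Qed.

(** The other exponents kappa p^l with l > 0 are divisible by p, hence outside K. *)
Lemma B0_basic kappa kappa' alpha : kappa \in K -> kappa' \in K ->
  B0 (basic kappa alpha) kappa' = if kappa == kappa' then alpha else 0.
Proof.
move=> kK k'K; have /KP[n n_gt0 [kE _]] := kK; have /KP[m m_gt0 [k'E _]] := k'K.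
rewrite k'E B0_qexp (basicP alpha kK).2 kE (inj_eq (@qexp_inj e)).
case: eqP => [->|nm].
  rewrite -[m in qcoef _ m]muln1 -(expn0 p) qcoef_log_basic_deriv //.
  by rewrite bcoef0 mul1r.
apply: qcoef_log_basic_deriv0 => // -[|l] E;
  first by rewrite E expn0 muln1 in nm.
move: k'K; rewrite k'E => /K_prime_to_p /negP[].
by rewrite E expnS dvdn_mull // dvdn_mulr.
Qed.

Definition solution a := \prod_(kappa <- K) basic kappa (a kappa).

Lemma U_solution a : U (solution a).
Proof.
rewrite /solution big_seq; apply: (big_ind U) => [||kappa /U_basic]; last exact.
  exact: U1.
exact: UM.
Qed.

Lemma B0_prod (F : int -> {qseries e, R}) kappa : (forall k, k \in K ->
  U (F k)) ->
  B0 (\prod_(k <- K) F k) kappa = \sum_(k <- K) B0 (F k) kappa.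
Proof.
move=> FU; rewrite /B0 psi_q_prod => [|k /FU /U_unit //]; rewrite qcoef_sum.
by case: ifP => // _; rewrite big1.
Qed.

Lemma B0_solution a : {in K, B0 (solution a) =1 a}.
Proof.
move=> kappa kK; rewrite B0_prod => [|k /U_basic //].
transitivity (\sum_(k <- K | k == kappa) a k).
  rewrite big_seq [RHS]big_mkcond [RHS]big_seq; apply: eq_bigr => k k_K.
  exact: B0_basic.
by rewrite -big_filter filter_pred1_uniq ?fset_uniq ?big_seq1.
Qed.

Lemma solution_B0 u : U u -> u = solution (B0 u).
Proof.
move=> uU; apply: (B0_U_inj uU (U_solution _)) => kappa kK.
by rewrite B0_solution.
Qed.

Lemma starE beta u : U u -> star beta u = solution (fun kappa =>
  beta * B0 u kappa).
Proof.
move=> uU; have starK a : \prod_(k <- K) star_kappa p k beta (basic k (a k)) =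
    solution (fun k => beta * a k).
  rewrite /solution [LHS]big_seq [RHS]big_seq; apply: eq_bigr => k kK;
    exact: star_kappa_basic.
apply: xget_unique => [|_ [w [wK uE ->]]].
  exists (fun kappa => basic kappa (B0 u kappa)); split=> [k _||].
  - by exists (B0 u k).
  - exact: solution_B0.
  - by rewrite starK.
have /choice[a aP] : forall kappa, exists alpha, kappa \in K ->
  basic kappa alpha = w kappa.
  move=> kappa; have [kK|] := boolP (kappa \in K); last by exists 0.
  by have [alpha _ E] := wK _ kK; exists alpha.
have wE (f : int -> {qseries e, R} -> {qseries e, R}) :
    \prod_(k <- K) f k (w k) = \prod_(k <- K) f k (basic k (a k)).
  by rewrite [LHS]big_seq [RHS]big_seq; apply: eq_bigr => k /aP ->.
(* B^0 recovers the parameters of an arbitrary factorization, so the choice in [star] is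
   harmless. *)
have aE : {in K, B0 u =1 a} by rewrite uE (wE (fun=> id)); apply: B0_solution.
rewrite (wE (fun k => star_kappa p k beta)) starK.
by rewrite /solution [LHS]big_seq [RHS]big_seq; apply: eq_bigr => k kK;
  rewrite aE.
Qed.

Lemma U_star beta u : U u -> U (star beta u).
Proof. by move=> uU; rewrite (starE _ uU); apply: U_solution. Qed.

Lemma B0_star beta u kappa : U u -> kappa \in K ->
  B0 (star beta u) kappa = beta * B0 u kappa.
Proof. by move=> uU kK; rewrite (starE _ uU) B0_solution. Qed.

(** Both sides of each identity lie in U, so it suffices to compare B^0, where [star] is
    multiplication in R. *)
Lemma U_mult_module : is_mult_module U star.
Proof.
split; [exact: U_unit | exact: U1 | exact: UM | exact: UV | exact: U_star |..].
- move=> b u v uU vU; have [buU bvU] := (U_star b uU, U_star b vU).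
  apply: (B0_U_inj (U_star b (UM uU vU)) (UM buU bvU)) => kappa kK.
  rewrite (B0M _ (U_unit buU) (U_unit bvU)).
  rewrite (B0_star b (UM uU vU) kK) (B0_star b uU kK) (B0_star b vU kK).
  by rewrite (B0M _ (U_unit uU) (U_unit vU)) mulrDr.
- move=> b b' u uU; have [buU bu'U] := (U_star b uU, U_star b' uU).
  apply: (B0_U_inj (U_star (b + b') uU) (UM buU bu'U)) => kappa kK.
  by rewrite (B0M _ (U_unit buU) (U_unit bu'U)) !(B0_star _ uU kK) mulrDl.
- move=> b b' u uU; have b'U := U_star b' uU.
  apply: (B0_U_inj (U_star (b * b') uU) (U_star b b'U)) => kappa kK.
  by rewrite (B0_star _ uU kK) (B0_star _ b'U kK) (B0_star _ uU kK) mulrA.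
- move=> u uU; apply: (B0_U_inj (U_star 1 uU) uU) => kappa kK.
  by rewrite (B0_star _ uU kK) mul1r.
Qed.

Lemma B0_pm_iso : is_mult_module_iso U star (@B0_pm p R nu lam e).
Proof.
split=> [u v uU vU|b u uU|].
- by apply/ffunP => kappa; rewrite !ffunE (B0M _ (U_unit uU) (U_unit vU)).
- by apply/ffunP => kappa; rewrite !ffunE (B0_star _ uU (fsvalP kappa)).
split=> // [u v /set_mem uU /set_mem vU uv|f _].
  apply: (B0_U_inj uU vU) => kappa kK.
  by have := congr1 (fun g : {ffun K -> R^o} => g [` kK]%fset) uv;
    rewrite !ffunE.
pose a kappa : R := if insub kappa is Some k then f k else 0.
exists (solution a); first exact: U_solution.
by apply/ffunP => k; rewrite ffunE (B0_solution a (fsvalP k)) /a valK.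
Qed.

Lemma U_basis_expansion u : U u ->
  u = \prod_(kappa <- K) star (B0 u kappa) (basic kappa 1).
Proof.
move=> uU; rewrite {1}(solution_B0 uU) /solution [LHS]big_seq [RHS]big_seq.
apply: eq_bigr => kappa kK; have bU := U_basic 1 kK.
apply: (B0_U_inj (U_basic _ kK) (U_star _ bU)) => k kK'.
apply: etrans (B0_basic _ kK kK') _; apply: etrans (esym (B0_star _ bU kK')).
rewrite (B0_basic _ kK kK').
by case: eqP => [->|]; rewrite ?mulr1 ?mulr0.
Qed.

End Solutions.

Theorem corollary7p12 (p : nat) (R : idomainType) (phi : {rmorphism R -> R})
    (nu : {poly {poly R}}) (lam : {poly R}) (e : bool)
    (p_prime : prime p) (p_neq2 : p != 2%N)
    (R_ur : is_completed_Zp_ur p R)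
    (phi_bij : bijective phi) (phi_frob : lifts_frobenius p phi)
    (m_nondeg : nondegenerate_char p nu lam) :
  [/\ is_mult_module (U_ p phi nu lam e) (star p phi nu lam),
      is_mult_module_iso (U_ p phi nu lam e) (star p phi nu lam)
        (B0_pm p nu lam)
    & forall u : qseries e R, U_ p phi nu lam e u ->
        u = \prod_(kappa <- K_ p nu lam e)
              star p phi nu lam (B0 u kappa) (basic p phi nu lam e kappa 1)].
Proof.
split; [exact: U_mult_module | exact: B0_pm_iso | exact: U_basis_expansion].
Qed.
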